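(* Let $(R,\mathfrak{m})$ and $(S,\mathfrak{n})$ be Noetherian local rings, let $\varphi\colon R\to R$ and $\psi\colon S\to S$ be endomorphisms of finite length, and let $f\colon R\to S$ be a flat local homomorphism satisfying $\psi\circ f=f\circ\varphi$. Let $\overline{\psi}\colon S/f(\mathfrak{m})S\to S/f(\mathfrak{m})S$ be the endomorphism induced by $\psi$. If $S$ is Cohen-Macaulay, then $$h_{\mathrm{loc}}(\psi)=h_{\mathrm{loc}}(\varphi)+h_{\mathrm{loc}}(\overline{\psi}).$$
   Context: All rings are Noetherian, local, commutative, with identity element $1$. A local homomorphism $g\colon(A,\mathfrak{a})\to(B,\mathfrak{b})$ of Noetherian local rings (so $g(\mathfrak{a})\subseteq\mathfrak{b}$) is said to be of finite length if the ideal $g(\mathfrak{a})B$ generated by the image of $\mathfrak{a}$ is $\mathfrak{b}$-primary; equivalently, the closed fiber $B/g(\mathfrak{a})B$ has dimension zero. An endomorphism of finite length of $A$ is a local homomorphism $A\to A$ that is of finite length. If $(A,\mathfrak{a})$ is a Noetherian local ring and $\theta\colon A\to A$ is an endomorphism of finite length, write $\theta^n$ for the $n$-fold composition of $\theta$ with itself and $\theta^n(\mathfrak{a})A$ for the ideal generated by the image of $\mathfrak{a}$. The local entropy of $\theta$ is $$h_{\mathrm{loc}}(\theta):=\lim_{n\to\infty}\frac{1}{n}\log\left(\operatorname{length}_A(A/\theta^n(\mathfrak{a})A)\right).$$ It is a known result that this limit always exists and is a nonnegative real number. When $f\colon(R,\mathfrak{m})\to(S,\mathfrak{n})$ is a local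 homomorphism with $\psi\circ f=f\circ\varphi$, one has $\psi(f(\mathfrak{m})S)\subseteq f(\mathfrak{m})S$, so $\psi$ induces an endomorphism $\overline{\psi}$ of the local ring $S/f(\mathfrak{m})S$, which is again of finite length. *)

(* Defs.v *)
From HB Require Import structures.
From mathcomp Require Import all_boot all_order all_algebra.
From mathcomp Require Import generic_quotient ring_quotient.
From mathcomp Require Import boolp classical_sets reals ereal constructive_ereal.
From mathcomp Require Import topology normedtype sequences exp.

Set Implicit Arguments.
Unset Strict Implicit.
Unset Printing Implicit Defensive.

Import Order.TTheory GRing.Theory Num.Theory.
Import numFieldNormedType.Exports.
Local Open Scope classical_set_scope.
Local Open Scope ring_scope.
Local Open Scope quotient_scope.

Definition submodule (A : pzRingType) (M : lmodType A) (N : set M) : Prop :=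
  submod_closed [in N].

Definition submod_gen (A : pzRingType) (M : lmodType A) (X : set M) : set M :=
  smallest (@submodule A M) X.

Lemma submod_gen_submodule (A : pzRingType) (M : lmodType A) (X : set M) :
  submodule (submod_gen X).
Proof.
split=> [|a u v /set_mem su /set_mem sv]; apply/mem_set => N [[N0 NL] XN].
  exact/set_mem.
by apply/set_mem/NL; apply/mem_set; [apply: su|apply: sv].
Qed.

Definition in_submod_gen (A : pzRingType) (M : lmodType A) (X : set M) : M -> bool :=
  fun x => x \in submod_gen X.

HB.instance Definition _ (A : pzRingType) (M : lmodType A) (X : set M) :=
  GRing.isSubmodClosed.Build A M (in_submod_gen X)
    (GRing.submod_closed_semi (submod_gen_submodule X)).

(* [quotmod X] is the quotient of M by the submodule generated by X. *)
Definition quotmod (A : pzRingType) (M : lmodType A) (X : set M) : Type :=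
  {ideal_quot (GRing.ZmodClosed.clone M (in_submod_gen X) _)}.

Section QuotMod.
Variables (A : pzRingType) (M : lmodType A) (X : set M).
Let Q := quotmod X.

HB.instance Definition _ := GRing.Zmodule.on (quotmod X).
HB.instance Definition _ := EqQuotient.on (quotmod X).

Lemma quotmod_eqP (x y : M) : \pi_Q x = \pi_Q y <-> submod_gen X (x - y).
Proof.
split=> [/eqP|h]; first by rewrite -Quotient.idealrBE => /set_mem.
by apply/eqP; rewrite -Quotient.idealrBE; apply/mem_set.
Qed.

Lemma quotmod_piD (x y : M) : \pi_Q (x + y) = \pi_Q x + \pi_Q y.
Proof. by rewrite (@pi_addr M _ 0 -%R +%R). Qed.

Lemma submod_gen_scale (a : A) (x : M) : submod_gen X x -> submod_gen X (a *: x).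
Proof.
have [s0 sL] := submod_gen_submodule X.
move=> /mem_set sx; apply/set_mem.
by rewrite -[_ *: _]addr0; apply: sL.
Qed.

Definition quotmod_scale (a : A) (q : Q) : Q := \pi_Q (a *: repr q).

Lemma quotmod_scale_pi (a : A) (x : M) :
  quotmod_scale a (\pi_Q x) = \pi_Q (a *: x).
Proof.
apply/quotmod_eqP; rewrite -scalerBr; apply: submod_gen_scale.
by apply/quotmod_eqP; rewrite reprK.
Qed.

Fact quotmod_scaleA a b (v : Q) :
  quotmod_scale a (quotmod_scale b v) = quotmod_scale (a * b) v.
Proof. by rewrite -[v]reprK (quotmod_scale_pi b) !quotmod_scale_pi scalerA. Qed.

Fact quotmod_scale1 : left_id 1 quotmod_scale.
Proof. by move=> v; rewrite -[v]reprK quotmod_scale_pi scale1r. Qed.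

Fact quotmod_scaleDr : right_distributive quotmod_scale +%R.
Proof.
move=> a u v; rewrite -[u]reprK -[v]reprK -quotmod_piD !quotmod_scale_pi.
by rewrite scalerDr quotmod_piD.
Qed.

Fact quotmod_scaleDl (v : Q) : {morph quotmod_scale^~ v : a b / a + b}.
Proof.
by move=> a b; rewrite -[v]reprK !quotmod_scale_pi scalerDl quotmod_piD.
Qed.

HB.instance Definition _ := GRing.Zmodule_isLmodule.Build A (quotmod X)
  quotmod_scaleA quotmod_scale1 quotmod_scaleDr quotmod_scaleDl.

End QuotMod.

Definition ideal (A : pzRingType) (I : set A) : Prop :=
  submodule (I : set A^o).

Definition ideal_gen (A : pzRingType) (X : set A) : set A :=
  submod_gen (X : set A^o).

(* [quotring X] is the quotient of A by the ideal generated by X. *)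
Definition quotring (A : comPzRingType) (X : set A) : Type :=
  quotmod (X : set A^o).

Section QuotRing.
Variables (A : comPzRingType) (X : set A).
Let Q := quotring X.

HB.instance Definition _ := GRing.Zmodule.on (quotring X).
HB.instance Definition _ := EqQuotient.on (quotring X).

Definition quotring_one : Q := \pi_Q (1 : A).
Definition quotring_mul (p q : Q) : Q := \pi_Q (repr p * repr q : A).

Lemma quotring_eqP (x y : A) : \pi_Q x = \pi_Q y <-> ideal_gen X (x - y).
Proof. exact: (@quotmod_eqP A A^o X x y). Qed.

Lemma quotring_piD (x y : A) : \pi_Q (x + y) = \pi_Q x + \pi_Q y.
Proof. exact: (@quotmod_piD A A^o X x y). Qed.

Lemma quotring_mul_pi (x y : A) :
  quotring_mul (\pi_Q x) (\pi_Q y) = \pi_Q (x * y).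
Proof.
have mull (a b c : A) : \pi_Q b = \pi_Q c -> \pi_Q (a * b) = \pi_Q (a * c).
  move=> /quotring_eqP bc; apply/quotring_eqP; rewrite -mulrBr.
  exact: (@submod_gen_scale A A^o X a).
rewrite /quotring_mul (mull _ _ y (reprK _)) mulrC.
by rewrite (mull _ _ x (reprK _)) mulrC.
Qed.

Fact quotring_mulA : associative quotring_mul.
Proof.
move=> x y z; rewrite -[x]reprK -[y]reprK -[z]reprK.
rewrite (quotring_mul_pi (repr y)) (quotring_mul_pi (repr x)).
by rewrite (quotring_mul_pi (repr x)) quotring_mul_pi mulrA.
Qed.

Fact quotring_mulC : commutative quotring_mul.
Proof.
by move=> x y; rewrite -[x]reprK -[y]reprK !quotring_mul_pi mulrC.
Qed.

Fact quotring_mul1 : left_id quotring_one quotring_mul.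
Proof. by move=> x; rewrite -[x]reprK quotring_mul_pi mul1r. Qed.

Fact quotring_mulDl : left_distributive quotring_mul +%R.
Proof.
move=> x y z; rewrite -[x]reprK -[y]reprK -[z]reprK.
by rewrite -quotring_piD !quotring_mul_pi mulrDl quotring_piD.
Qed.

HB.instance Definition _ := GRing.Zmodule_isComPzRing.Build (quotring X)
  quotring_mulA quotring_mulC quotring_mul1 quotring_mulDl.

End QuotRing.

(* An endomorphism of A preserving the ideal (X) induces an endomorphism of
   A/(X), uniquely determined by its compatibility with the projection. *)
Lemma quotring_endo_ex (A : comPzRingType) (X : set A)
    (psi : {rmorphism A -> A}) :
  (forall x, ideal_gen X x -> ideal_gen X (psi x)) ->
  exists psibar : {rmorphism quotring X -> quotring X},
    forall x : A, psibar (\pi_(quotring X) x) = \pi_(quotring X) (psi x).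
Proof.
move=> psiX; pose g (q : quotring X) : quotring X := \pi_(quotring X) (psi (repr q)).
have gpi (x : A) : g (\pi_(quotring X) x) = \pi_(quotring X) (psi x).
  apply/quotring_eqP; rewrite -rmorphB; apply: psiX.
  by apply/quotring_eqP; rewrite reprK.
have gB : zmod_morphism g.
  move=> p q; rewrite -[p]reprK -[q]reprK.
  have piB (x y : A) : \pi_(quotring X) (x - y) = \pi_(quotring X) x - \pi_(quotring X) y.
    by apply: (addIr (\pi_(quotring X) y)); rewrite -quotring_piD !subrK.
  by rewrite -piB !gpi rmorphB piB.
have gM : monoid_morphism g.
  split=> [|p q]; first by rewrite [LHS]gpi rmorph1.
  rewrite -[p]reprK -[q]reprK [X in g X]quotring_mul_pi !gpi rmorphM.
  by rewrite -[LHS]quotring_mul_pi.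
pose gA := GRing.isZmodMorphism.Build _ _ g gB.
pose gR := GRing.isMonoidMorphism.Build _ _ g gM.
pose gg : {rmorphism quotring X -> quotring X} :=
  HB.pack g gA gR.
by exists gg.
Qed.

Lemma ideal_gen_endo (A B : comPzRingType) (a : set A)
    (f : {rmorphism A -> B}) (phi : {rmorphism A -> A})
    (psi : {rmorphism B -> B}) :
  psi \o f =1 f \o phi -> phi @` a `<=` a ->
  forall x, ideal_gen (f @` a) x -> ideal_gen (f @` a) (psi x).
Proof.
move=> psif phia; set J := ideal_gen _.
suff : J `<=` psi @^-1` J by [].
apply: smallest_sub => [|_ [y ay <-]].
  have [/set_mem J0 JL] := submod_gen_submodule (f @` a : set B^o).
  split=> [|c u v /set_mem Ju /set_mem Jv]; apply/mem_set; rewrite /preimage/=.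
    by rewrite rmorph0.
  rewrite rmorphD rmorphM; apply/set_mem.
  by apply: JL; apply/mem_set.
apply: sub_gen_smallest; exists (phi y); last exact/esym/psif.
by apply: phia; exists y.
Qed.

Definition maximal_ideal (A : pzRingType) (I : set A) : Prop :=
  [/\ ideal I, I <> setT &
      forall J : set A, ideal J -> I `<=` J -> J = I \/ J = setT].

Definition prime_ideal (A : pzRingType) (P : set A) : Prop :=
  [/\ ideal P, P <> setT & forall x y : A, P (x * y) -> P x \/ P y].

Definition primary_ideal (A : pzRingType) (Q : set A) : Prop :=
  [/\ ideal Q, Q <> setT &
      forall x y : A, Q (x * y) -> Q x \/ exists k : nat, Q (y ^+ k)].

Definition radical (A : pzRingType) (I : set A) : set A :=
  [set x | exists k : nat, I (x ^+ k)].

Definition noetherian (A : pzRingType) : Prop :=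
  forall I : set A, ideal I -> exists s : seq A, I = ideal_gen [set` s].

Definition noetherian_local (A : pzRingType) (a : set A) : Prop :=
  [/\ noetherian A, maximal_ideal a &
      forall b : set A, maximal_ideal b -> b = a].

Definition local_hom (A B : pzRingType) (a : set A) (b : set B) (g : A -> B) :
    Prop :=
  g @` a `<=` b.

Definition finite_length_hom (A B : pzRingType) (a : set A) (b : set B)
    (g : A -> B) : Prop :=
  local_hom a b g /\
  (primary_ideal (ideal_gen (g @` a)) /\ radical (ideal_gen (g @` a)) = b).

(* The underlying group of B, as an A-module through f. *)
Definition restrict (A B : pzRingType) (f : {rmorphism A -> B}) : Type := B.

Section Restrict.
Variables (A B : pzRingType) (f : {rmorphism A -> B}).

HB.instance Definition _ := GRing.Zmodule.on (restrict f).

Let scale (a : A) (b : restrict f) : restrict f := (f a * (b : B) : B).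

Fact restrict_scaleA a b v : scale a (scale b v) = scale (a * b) v.
Proof. by rewrite /scale rmorphM mulrA. Qed.

Fact restrict_scale1 : left_id 1 scale.
Proof. by move=> v; rewrite /scale rmorph1 mul1r. Qed.

Fact restrict_scaleDr : right_distributive scale +%R.
Proof. by move=> a u v; rewrite /scale mulrDr. Qed.

Fact restrict_scaleDl v : {morph scale^~ v : a b / a + b}.
Proof. by move=> a b; rewrite /scale rmorphD mulrDl. Qed.

HB.instance Definition _ := GRing.Zmodule_isLmodule.Build A (restrict f)
  restrict_scaleA restrict_scale1 restrict_scaleDr restrict_scaleDl.

End Restrict.

(* A sequence [:: (m_1, n_1); ...; (m_k, n_k)] stands for the formal sum
   m_1 (x) n_1 + ... + m_k (x) n_k; two such sums are related exactly when they
   are the same element of the tensor product of M and N over A. Opposites need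
   no separate generator, since - (m (x) n) = (- m) (x) n. *)
Inductive tensor_eq (A : comPzRingType) (M N : lmodType A) :
    seq (M * N) -> seq (M * N) -> Prop :=
| tensor_refl t : tensor_eq t t
| tensor_sym t u : tensor_eq t u -> tensor_eq u t
| tensor_trans t u v : tensor_eq t u -> tensor_eq u v -> tensor_eq t v
| tensor_cat t t' u u' :
    tensor_eq t t' -> tensor_eq u u' -> tensor_eq (t ++ u) (t' ++ u')
| tensor_catC t u : tensor_eq (t ++ u) (u ++ t)
| tensor_0l n : tensor_eq [:: (0, n)] [::]
| tensor_Dl m m' n : tensor_eq [:: (m + m', n)] [:: (m, n); (m', n)]
| tensor_Dr m n n' : tensor_eq [:: (m, n + n')] [:: (m, n); (m, n')]
| tensor_Z a m n : tensor_eq [:: (a *: m, n)] [:: (m, a *: n)].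

Definition tensor_map (A : comPzRingType) (M M' N : lmodType A) (u : M -> M')
    (t : seq (M * N)) : seq (M' * N) :=
  [seq (u p.1, p.2) | p <- t].

Definition flat_module (A : comPzRingType) (N : lmodType A) : Prop :=
  forall (M M' : lmodType A) (u : {linear M -> M'}), injective u ->
  forall t t' : seq (M * N),
    tensor_eq (tensor_map u t) (tensor_map u t') -> tensor_eq t t'.

Definition flat_hom (A B : comPzRingType) (f : {rmorphism A -> B}) : Prop :=
  flat_module (restrict f).

Definition prime_chain (A : pzRingType) (d : nat) : Prop :=
  exists P : nat -> set A,
    (forall i, (i <= d)%N -> prime_ideal (P i)) /\
    (forall i, (i < d)%N -> P i `<` P i.+1).

Definition regular_sequence (A : comPzRingType) (s : seq A) : Prop :=
  ideal_gen [set` s] <> setT /\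
  forall i, (i < size s)%N ->
    forall y : quotmod ([set` take i s] : set A^o), s`_i *: y = 0 -> y = 0.

Definition is_max (P : nat -> Prop) (d : nat) : Prop :=
  P d /\ forall k, P k -> (k <= d)%N.

Definition krull_dim (A : pzRingType) (d : nat) : Prop :=
  is_max (@prime_chain A) d.

Definition depth (A : comPzRingType) (a : set A) (d : nat) : Prop :=
  is_max (fun k => exists s : seq A,
    [/\ size s = k, [set` s] `<=` a & regular_sequence s]) d.

(* Dimension and depth of a Noetherian local ring are always finite. *)
Definition cohen_macaulay (A : comPzRingType) (a : set A) : Prop :=
  exists d : nat, krull_dim A d /\ depth a d.

Definition submodule_chain (A : pzRingType) (M : lmodType A) (l : nat) : Prop :=
  exists N : nat -> set M,
    (forall i, (i <= l)%N -> submodule (N i)) /\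
    (forall i, (i < l)%N -> N i `<` N i.+1).

Definition module_length (K : realType) (A : pzRingType) (M : lmodType A) :
    \bar K :=
  ereal_sup [set (l%:R%:E : \bar K) | l in @submodule_chain A M].

(* For theta of finite length, the lengths below are finite and positive, so [fine]
   loses nothing. *)
Definition local_entropy (K : realType) (A : comPzRingType) (a : set A)
    (theta : A -> A) : K :=
  limn (fun n : nat => n%:R^-1 *
    ln (fine (module_length K
      (quotmod ((iter n theta @` a) : set A^o)))) : K).

(* Main.v *)
Require Import Defs.
From HB Require Import structures.
From mathcomp Require Import all_boot all_order all_algebra.
From mathcomp Require Import generic_quotient ring_quotient.
From mathcomp Require Import boolp classical_sets reals ereal constructive_ereal.
From mathcomp Require Import topology normedtype sequences exp.
From mathcomp Require Import ring lra.
Import Order.TTheory GRing.Theory Num.Theory.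
Import numFieldNormedType.Exports.
Local Open Scope classical_set_scope.
Local Open Scope ring_scope.
Local Open Scope quotient_scope.

Set Implicit Arguments.
Unset Strict Implicit.
Unset Printing Implicit Defensive.

(* Write l for length. If S is Cohen-Macaulay and flat over R, there is a sequence
   y in n that is regular modulo mS and such that q = mS + (y) is n-primary: take
   a maximal y regular modulo mS and a maximal regular sequence x of R. Flatness
   makes (y, x) a maximal regular sequence of S, so it has dim S terms and
   generates an n-primary ideal.

   For every k, psi^k(y) still generates an n-primary ideal modulo mS, and it has
   as many terms as depth S/mS, so it is regular modulo mS after a change of
   generators. Hence S/psi^k(y)S is again flat over R, and
     l(S/psi^k(q)S) = l(R/phi^k(m)R) * l(S/(mS + psi^k(y)S)).
   Replacing q by n changes the outer lengths by a factor at most l(S/q), which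
   the limits of log l / k do not see. The limits exist by Fekete's lemma because
   the lengths are submultiplicative in k. *)

(** * Ideals of a commutative ring *)

(** The obstacle is that [psi] need not be flat, so the length of S/psi^k(n)S obeys no product
    formula. The ideal q is chosen so that one exists: psi o f = f o phi gives psi^k(q)S = phi^k(m)S
    + psi^k(y)S, whose first summand is extended from R and whose second leaves a quotient flat over
    R. Cohen-Macaulayness enters through y alone: it makes some sequence regular modulo mS a system
    of parameters of the fiber, and then the parameters psi^k(y) span the same ideals as a regular
    sequence.

    The factor l(S/q) costs no flatness: psi^k carries a composition series of S/q to a filtration
    of S/psi^k(q)S whose steps are quotients of S/psi^k(n)S.

    Quotient rings and modules are avoided throughout. Regularity, depth and length modulo I are
    statements about ideals of one fixed ring, and flatness of S/J over R is used only as (IS + J) :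
    f(a) = (I : a)S + J. *)

Section Ideals.
Variable A : comNzRingType.
Implicit Types (I J K : set A) (a b c x y : A) (s : seq A).

Lemma idealP I :
  ideal I <-> I 0 /\ forall a x y, I x -> I y -> I (a * x + y).
Proof.
split=> [[/set_mem I0 IL]|[I0 IL]].
  by split=> // a x y Ix Iy; apply/set_mem/(IL a x y); apply/mem_set.
split=> [|a x y /set_mem Ix /set_mem Iy]; apply/mem_set => //.
exact: (IL a x y).
Qed.

Lemma ideal0 I : ideal I -> I 0. Proof. by case/idealP. Qed.

Lemma ideal_mull I a x : ideal I -> I x -> I (a * x).
Proof. by case/idealP=> I0 IL Ix; rewrite -[a * x]addr0; apply: IL. Qed.

Lemma ideal_mulr I a x : ideal I -> I x -> I (x * a).
Proof. by rewrite mulrC; apply: ideal_mull. Qed.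

Lemma idealD I x y : ideal I -> I x -> I y -> I (x + y).
Proof. by case/idealP=> I0 IL Ix Iy; rewrite -[x]mul1r; apply: IL. Qed.

Lemma idealN I x : ideal I -> I x -> I (- x).
Proof. by move=> iI Ix; rewrite -mulN1r; apply: ideal_mull. Qed.

Lemma idealB I x y : ideal I -> I x -> I y -> I (x - y).
Proof. by move=> iI Ix Iy; apply: idealD => //; apply: idealN. Qed.

Lemma ideal_congr I x y : ideal I -> I (x - y) -> I y -> I x.
Proof. by move=> iI Ixy Iy; rewrite -[x](subrK y); apply: idealD. Qed.

Lemma ideal_set0 : ideal [set 0 : A].
Proof. by apply/idealP; split=> // a x y -> ->; rewrite mulr0 addr0. Qed.

Lemma ideal_setT : ideal [set: A].
Proof. exact/idealP. Qed.

Lemma ideal_gen_ideal (X : set A) : ideal (ideal_gen X).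
Proof. exact: (@submod_gen_submodule A A^o). Qed.

Lemma sub_ideal_gen (X : set A) : X `<=` ideal_gen X.
Proof. exact: sub_gen_smallest. Qed.

Lemma ideal_gen_min (X J : set A) : ideal J -> X `<=` J -> ideal_gen X `<=` J.
Proof. exact: smallest_sub. Qed.

Lemma ideal_gen_id I : ideal I -> ideal_gen I = I.
Proof.
by move=> iI; apply/seteqP; split; [apply: ideal_gen_min|apply: sub_ideal_gen].
Qed.

Definition proper_ideal I := ~ I 1.

Lemma ideal1 I : ideal I -> I 1 -> I = setT.
Proof.
by move=> iI I1; apply/seteqP; split=> // x _; rewrite -[x]mulr1; apply: ideal_mull.
Qed.

Lemma proper_idealT I : ideal I -> I <> setT -> proper_ideal I.
Proof. by move=> iI + I1; apply; apply: ideal1. Qed.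

Definition adjoin I a : set A := [set x | exists c, I (x - c * a)].
Definition adjoin_seq I s : set A := foldl adjoin I s.
Definition ideal_sum I J : set A := [set x | exists2 j, J j & I (x - j)].
Definition colon I a : set A := [set x | I (x * a)].

Lemma ideal_adjoin I a : ideal I -> ideal (adjoin I a).
Proof.
move=> iI; apply/idealP; split; first by exists 0; rewrite mul0r subr0; apply: ideal0.
move=> b x y [c Ix] [d Iy]; exists (b * c + d).
have -> : b * x + y - (b * c + d) * a = b * (x - c * a) + (y - d * a) by ring.
by apply: idealD => //; apply: ideal_mull.
Qed.

Lemma sub_adjoin I a : I `<=` adjoin I a.
Proof. by move=> x Ix; exists 0; rewrite mul0r subr0. Qed.

Lemma adjoin_self I a : ideal I -> adjoin I a a.
Proof. by move=> iI; exists 1; rewrite mul1r subrr; apply: ideal0. Qed.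

Lemma adjoin_min I J a : ideal J -> I `<=` J -> J a -> adjoin I a `<=` J.
Proof.
move=> iJ IJ Ja x [c /IJ Jx]; apply: (ideal_congr iJ Jx); exact: ideal_mull.
Qed.

Lemma adjoinS I J a : I `<=` J -> adjoin I a `<=` adjoin J a.
Proof. by move=> IJ x [c /IJ Jx]; exists c. Qed.

Lemma adjoin_id I a : ideal I -> I a -> adjoin I a = I.
Proof.
by move=> iI Ia; apply/seteqP; split; [apply: adjoin_min|apply: sub_adjoin].
Qed.

Lemma adjoinC I a b : ideal I -> adjoin (adjoin I a) b = adjoin (adjoin I b) a.
Proof.
suff h c d : ideal I -> adjoin (adjoin I c) d `<=` adjoin (adjoin I d) c.
  by move=> iI; apply/seteqP; split; apply: h.
move=> iI; have iId : ideal (adjoin I d) by exact: ideal_adjoin.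
apply: adjoin_min; first exact: ideal_adjoin.
  exact/adjoinS/sub_adjoin.
by apply: sub_adjoin; apply: adjoin_self.
Qed.

Lemma ideal_adjoin_seq I s : ideal I -> ideal (adjoin_seq I s).
Proof. by elim: s I => //= x s IH I iI; apply/IH/ideal_adjoin. Qed.

Lemma sub_adjoin_seq I s : I `<=` adjoin_seq I s.
Proof.
by elim: s I => [|a s IH] I x Ix //; apply/IH/sub_adjoin.
Qed.


Lemma adjoin_seq_self I s x : ideal I -> x \in s -> adjoin_seq I s x.
Proof.
elim: s I => //= y s IH I iI; rewrite inE => /predU1P[->|xs].
  by apply: sub_adjoin_seq; apply: adjoin_self.
by apply: IH => //; apply: ideal_adjoin.
Qed.

Lemma adjoin_seq_min I J s : ideal J -> I `<=` J -> {in s, forall x, J x} ->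
  adjoin_seq I s `<=` J.
Proof.
move=> iJ; elim: s I => //= y s IH I IJ sJ; apply: IH => [|x xs].
  by apply: adjoin_min => //; apply: sJ; rewrite mem_head.
by apply: sJ; rewrite inE xs orbT.
Qed.

Lemma adjoin_seqS I J s : I `<=` J -> adjoin_seq I s `<=` adjoin_seq J s.
Proof. by elim: s I J => //= x s IH I J IJ; apply/IH/adjoinS. Qed.

Lemma adjoin_seq_adjoin I s a : ideal I ->
  adjoin_seq (adjoin I a) s = adjoin (adjoin_seq I s) a.
Proof.
elim: s I => //= x s IH I iI.
by rewrite adjoinC // IH //; apply: ideal_adjoin.
Qed.

Lemma adjoin_seq_cat I s1 s2 :
  adjoin_seq I (s1 ++ s2) = adjoin_seq (adjoin_seq I s1) s2.
Proof. exact: foldl_cat. Qed.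

Lemma ideal_gen_seq s : ideal_gen [set` s] = adjoin_seq [set 0] s.
Proof.
have i0 := ideal_set0.
have iG := ideal_gen_ideal [set` s].
apply/seteqP; split.
  apply: ideal_gen_min => [|x /= xs]; first exact: ideal_adjoin_seq.
  exact: adjoin_seq_self.
apply: adjoin_seq_min => // [_ ->|x xs]; first exact: ideal0.
exact: sub_ideal_gen.
Qed.

Lemma ideal_ideal_sum I J : ideal I -> ideal J -> ideal (ideal_sum I J).
Proof.
move=> iI iJ; apply/idealP; split.
  by exists 0; [apply: ideal0|rewrite subr0; apply: ideal0].
move=> a x y [i Ji Ix] [j Jj Iy]; exists (a * i + j).
  by apply: idealD => //; apply: ideal_mull.
have -> : a * x + y - (a * i + j) = a * (x - i) + (y - j) by ring.
by apply: idealD => //; apply: ideal_mull.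
Qed.

Lemma sub_ideal_suml I J : ideal J -> I `<=` ideal_sum I J.
Proof. by move=> iJ x Ix; exists 0; [apply: ideal0|rewrite subr0]. Qed.

Lemma sub_ideal_sumr I J : ideal I -> J `<=` ideal_sum I J.
Proof. by move=> iI x Jx; exists x => //; rewrite subrr; apply: ideal0. Qed.

Lemma ideal_sum_min I J K : ideal K -> I `<=` K -> J `<=` K -> ideal_sum I J `<=` K.
Proof. by move=> iK IK JK x [j /JK Kj /IK Kx]; apply: (ideal_congr iK Kx). Qed.

Lemma ideal_sumS I I' J J' : I `<=` I' -> J `<=` J' ->
  ideal_sum I J `<=` ideal_sum I' J'.
Proof. by move=> II' JJ' x [j /JJ' Jj /II' Ix]; exists j. Qed.

Lemma ideal_sum_adjoinr I J a : ideal I -> ideal J ->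
  ideal_sum I (adjoin J a) = adjoin (ideal_sum I J) a.
Proof.
move=> iI iJ; have iIJ := ideal_ideal_sum iI iJ.
have iJa := ideal_adjoin a iJ.
apply/seteqP; split.
  apply: ideal_sum_min; first exact: ideal_adjoin.
    by move=> x Ix; apply/sub_adjoin/sub_ideal_suml.
  by apply/adjoinS/sub_ideal_sumr.
apply: adjoin_min; first exact: ideal_ideal_sum.
  by apply: ideal_sumS => //; apply: sub_adjoin.
by apply: sub_ideal_sumr => //; apply: adjoin_self.
Qed.

Lemma ideal_sum_adjoin_seqr I J s : ideal I -> ideal J ->
  ideal_sum I (adjoin_seq J s) = adjoin_seq (ideal_sum I J) s.
Proof.
move=> iI; elim: s J => //= a s IH J iJ.
by rewrite -ideal_sum_adjoinr // IH //; apply: ideal_adjoin.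
Qed.

Lemma ideal_colon I a : ideal I -> ideal (colon I a).
Proof.
move=> iI; apply/idealP; split; first by rewrite /colon /= mul0r; apply: ideal0.
move=> b x y Ix Iy; rewrite /colon /= mulrDl -mulrA.
by apply: idealD => //; apply: ideal_mull.
Qed.

Lemma sub_colon I a : ideal I -> I `<=` colon I a.
Proof. by move=> iI x Ix; apply: ideal_mulr. Qed.

(** A counterexample would start, by choice, an infinite strictly increasing chain of
    counterexamples; the union is finitely generated, hence equal to one term. *)
Lemma noetherian_ind (nA : noetherian A) (P : set A -> Prop) :
  (forall I, ideal I -> (forall J, ideal J -> I `<` J -> P J) -> P I) ->
  forall I, ideal I -> P I.
Proof.
move=> Pstep I0 iI0; apply: contrapT => nPI0.
pose bad := {I : set A | ideal I /\ ~ P I}.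
have next (I : bad) : exists J : bad, sval I `<` sval J.
  case: I => I /= [iI nPI]; apply: contrapT => noJ; apply/nPI/Pstep => // J iJ IJ.
  by apply: contrapT => nPJ; apply: noJ; exists (exist _ J (conj iJ nPJ)).
have [g gP] := choice next.
pose F k := sval (iter k g (exist _ I0 (conj iI0 nPI0) : bad)).
have iF k : ideal (F k).
  by case: (proj2_sig (iter k g (exist _ I0 (conj iI0 nPI0)))).
have FS k : F k `<` F k.+1 by exact: gP.
have Fmono k l : (k <= l)%N -> F k `<=` F l.
  elim: l => [|l IH]; rewrite leq_eqVlt => /predU1P[->|]//.
  by move=> /IH/subset_trans; apply; case: (FS l).
pose U := [set x | exists k, F k x].
have iU : ideal U.
  apply/idealP; split; first by exists 0%N; apply: ideal0.
  move=> a x y [k Fx] [l Fy]; exists (maxn k l); apply: idealD => //.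
    by apply: ideal_mull => //; apply: Fmono Fx; apply: leq_maxl.
  by apply: Fmono Fy; apply: leq_maxr.
have [s Us] := nA U iU.
have [k sk] : exists k, {in s, forall x, F k x}.
  have : {in s, forall x, U x} by move=> x xs; rewrite Us; apply: sub_ideal_gen.
  elim: s {Us} => [|x s IH] sU; first by exists 0%N.
  have [k sk] : exists k, {in s, forall x, F k x}.
    by apply: IH => y ys; apply: sU; rewrite inE ys orbT.
  have [l Fx] : U x by apply: sU; rewrite mem_head.
  exists (maxn k l) => y; rewrite inE => /predU1P[->|/sk].
    by apply: Fmono Fx; apply: leq_maxr.
  by apply: Fmono; apply: leq_maxl.
have [_] := FS k; apply => x Fx; have : U x by exists k.+1.
by rewrite Us; apply: ideal_gen_min.
Qed.

End Ideals.

(** * Zero divisors and prime avoidance *)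

Section Avoidance.
Variable A : comNzRingType.
Implicit Types (I J K P : set A) (a b c u v x y : A).

Definition regular_mod I a := forall x, I (a * x) -> I x.

(** Take the product of one element outside [P] from each [Q t]. *)
Lemma prime_not_sub_all (T : eqType) (Q : T -> set A) (ts : seq T) P :
  prime_ideal P -> {in ts, forall t, ideal (Q t) /\ ~ (Q t `<=` P)} ->
  exists2 r, ~ P r & {in ts, forall t, Q t r}.
Proof.
move=> [iP /(proper_idealT iP) P1 pP]; elim: ts => [|t ts IH] QP; first by exists 1.
have [u uts|r Pr Qr] := IH; first by apply: QP; rewrite inE uts orbT.
have [iQ /existsNP[q /not_implyP[Qq Pq]]] := QP t (mem_head _ _).
exists (q * r); first by case/pP.
move=> u; rewrite inE => /predU1P[->|uts]; first exact: (ideal_mulr _ iQ).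
by apply: ideal_mull (Qr u uts); have [] := QP u; rewrite // inE uts orbT.
Qed.

(* Primes of the list contained in the head P need no separate treatment:
   whatever avoids P avoids them. *)
Lemma coset_prime_avoidance J a (Ps : seq (set A)) : ideal J ->
  {in Ps, forall P, prime_ideal P /\ ~ (adjoin J a `<=` P)} ->
  exists2 v, J (v - a) & {in Ps, forall P, ~ P v}.
Proof.
move=> iJ; have [k] := ubnP (size Ps); elim: k Ps => // k IH [|P Ps] /=.
  by exists a => //; rewrite subrr; apply: ideal0.
rewrite ltnS => szPs hPs.
have [pP JP] := hPs P (mem_head _ _); have [iP _ mP] := pP.
pose Qs := [seq Q <- Ps | ~~ `[< Q `<=` P >]].
have QsP Q : Q \in Qs -> ~ (Q `<=` P) /\ Q \in Ps.
  by rewrite mem_filter => /andP[/asboolPn].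
have [||v Jv Qv] := IH Qs.
- by rewrite size_filter (leq_ltn_trans (count_size _ _)).
- by move=> Q /QsP[_ Qs']; apply: hPs; rewrite inE Qs' orbT.
have iPs Q : Q \in Ps -> ideal Q.
  by move=> QPs; have [|[]] := hPs Q _; rewrite ?inE ?QPs ?orbT.
have close w : ~ P w -> {in Qs, forall Q, ~ Q w} -> {in P :: Ps, forall Q, ~ Q w}.
  move=> Pw Qw Q; rewrite inE => /predU1P[->//|QPs].
  have [QP /QP//|QP] := pselect (Q `<=` P).
  by apply: Qw; rewrite mem_filter QPs andbT; apply/asboolPn.
have [Pv|Pv] := pselect (P v); last by exists v => //; apply: close.
have [j Jj Pj] : exists2 j, J j & ~ P j.
  apply: contrapT => noj; apply: JP; apply: adjoin_min => //.
    by move=> j Jj; apply: contrapT => Pj; apply: noj; exists j.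
  have -> : a = v - (v - a) by ring.
  by apply: idealB => //; apply: contrapT => Pva; apply: noj; exists (v - a).
(* Adding r j moves [v] out of [P], since neither factor is in [P], and keeps it outside every prime
   of [Qs], since [r] lies in all of them. *)
have [Q /QsP[QP /iPs]|r Pr Qr] := @prime_not_sub_all _ id Qs P pP; first by [].
exists (v + r * j).
  have -> : v + r * j - a = v - a + r * j by ring.
  by apply: idealD => //; apply: ideal_mull.
apply: close => [Pvrj|Q QQs Qvrj].
  have /mP[] // : P (r * j).
  have -> : r * j = v + r * j - v by ring.
  exact: idealB.
have iQ : ideal Q by apply: iPs; have [] := QsP Q QQs.
apply: (Qv Q QQs); have -> : v = v + r * j - r * j by ring.
by apply: idealB => //; apply: ideal_mulr => //; apply: Qr.
Qed.

Lemma prime_radical I P : prime_ideal P -> I `<=` P -> radical I `<=` P.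
Proof.
move=> [iP /(proper_idealT iP) P1 mP] IP x [k /IP]; elim: k => [/P1//|k IH].
by rewrite exprS => /mP[].
Qed.

(** Here [colon I u] is the annihilator of the class of u in A/I; the maximal ones are the maximal
    associated primes of A/I. *)
Definition max_annihilator I u :=
  ~ I u /\ forall v, ~ I v -> colon I u `<=` colon I v -> colon I v `<=` colon I u.

Lemma max_annihilator_prime I u : ideal I ->
  max_annihilator I u -> prime_ideal (colon I u).
Proof.
move=> iI [Iu umax]; split; first exact: ideal_colon.
  by move=> cT; have : colon I u 1; [rewrite cT|rewrite /colon /= mul1r].
move=> x y; rewrite /colon /= => Ixyu.
have [|Ixu] := pselect (I (x * u)); [by left|right].
apply: (umax _ Ixu) => [z|]; rewrite /colon /=.
  by rewrite mulrCA; apply: ideal_mull.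
by rewrite mulrCA mulrA.
Qed.

Hypothesis nA : noetherian A.

Lemma max_annihilator_ex I u : ideal I -> ~ I u ->
  exists2 v, max_annihilator I v & colon I u `<=` colon I v.
Proof.
move=> iI; move: (ideal_colon u iI).
move: {-2}(colon I u) (erefl (colon I u)) => L + iL.
elim/(noetherian_ind nA): L / iL u => L iL IH u LE Iu.
have [umax|] := pselect (max_annihilator I u); first by exists u; rewrite -?LE.
move=> /not_andP[//|/existsNP[v /not_implyP[Iv /not_implyP[uv vu]]]].
have ltv : L `<` colon I v by rewrite LE.
have [w wmax vw] := IH _ (ideal_colon v iI) ltv v erefl Iv.
by exists w => //; case: ltv => + _; move/subset_trans; apply.
Qed.

(** Invariant of the Noetherian induction: whatever multiplies all of [us] into [I] multiplies [L]
    into [I]. If a zero divisor is not covered, a maximal annihilator [w] above it gives a prime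
    containing no [colon I u], so some r kills all of [us] but not [w]. Hence [w] is outside [L],
    and adjoining it enlarges [L]. *)
Lemma max_annihilators_finite I : ideal I ->
  exists2 us : seq A, {in us, forall u, max_annihilator I u} &
    forall x v, ~ I v -> I (x * v) -> exists2 u, u \in us & I (x * u).
Proof.
move=> iI.
suff : forall L, ideal L -> forall us : seq A,
  {in us, forall u, max_annihilator I u} ->
  (forall v x, L v -> {in us, forall u, I (x * u)} -> I (x * v)) ->
  exists2 us : seq A, {in us, forall u, max_annihilator I u} &
    forall x v, ~ I v -> I (x * v) -> exists2 u, u \in us & I (x * u).
  by move=> /(_ I iI [::]); apply=> // v x Iv _; apply: ideal_mull.
move=> L iL; elim/(noetherian_ind nA): L / iL => L iL IH us usmax Lus.
apply: contrapT => notall.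
have [x [v [Iv [Ixv nous]]]] : exists x v, ~ I v /\ I (x * v) /\
    ~ exists2 u, u \in us & I (x * u).
  apply: contrapT => nox; apply: notall; exists us => // x v Iv Ixv.
  by apply: contrapT => nou; apply: nox; exists x, v.
have [w wmax vw] := max_annihilator_ex iI Iv.
have Ixw : I (x * w) by exact: vw.
have Lw : ~ L w.
  move=> Lw; have [u uus|r Iw] := prime_not_sub_all (Q := colon I) (ts := us)
      (max_annihilator_prime iI wmax).
  - split=> [|uw]; first exact: ideal_colon.
    apply: nous; exists u => //; have [_ umax] := usmax u uus.
    by have [Iw _] := wmax; apply: (umax w Iw uw).
  - by move=> rus; apply/Iw/Lus.
apply: notall; apply: (IH (adjoin L w) _ _ (w :: us)).
- exact: ideal_adjoin.
- by split; [apply: sub_adjoin|move=> /(_ w); move/(_ (adjoin_self w iL))].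
- by move=> u; rewrite inE => /predU1P[->|/usmax].
move=> z y [c Lz] zus.
have -> : y * z = y * (z - c * w) + c * (y * w) by ring.
apply: idealD => //.
  by apply: Lus => // u uus; apply: zus; rewrite inE uus orbT.
by apply: ideal_mull => //; apply: zus; rewrite mem_head.
Qed.

(** An associated prime [colon I u] containing [J] and [a] would make u a nonzero class killed by
    both. So the coset a + J can avoid the finitely many maximal annihilators of all the ideals
    listed. *)
Lemma regular_avoidance (Is : seq (set A)) J a : ideal J ->
  {in Is, forall I, ideal I /\
    forall u, I (a * u) -> (forall j, J j -> I (j * u)) -> I u} ->
  exists2 v, J (v - a) & {in Is, forall I, regular_mod I v}.
Proof.
move=> iJ hIs.
suff [Ps hPs Psreg] : exists2 Ps : seq (set A),
    {in Ps, forall P, prime_ideal P /\ ~ (adjoin J a `<=` P)} &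
    forall v, {in Ps, forall P, ~ P v} -> {in Is, forall I, regular_mod I v}.
  by have [v Jv Pv] := coset_prime_avoidance iJ hPs; exists v => //; apply: Psreg.
elim: Is hIs => [|I Is IH] hIs; first by exists [::].
have [I' I'Is|Ps hPs Psreg] := IH; first by apply: hIs; rewrite inE I'Is orbT.
have [iI Ireg] := hIs I (mem_head _ _).
have [us usmax uscover] := max_annihilators_finite iI.
exists ([seq colon I u | u <- us] ++ Ps) => [P|v vPs I'].
  rewrite mem_cat => /orP[/mapP[u uus ->]|/hPs//].
  have umax := usmax u uus; split; first exact: max_annihilator_prime.
  move=> sub; have [Iu _] := umax; apply/Iu/Ireg; first exact/sub/adjoin_self.
  by move=> j Jj; apply/sub/sub_adjoin.
rewrite inE => /predU1P[->|I'Is]; last first.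
  by apply: Psreg => // P PPs; apply: vPs; rewrite mem_cat PPs orbT.
move=> x Ivx; apply: contrapT => Ix; have [u uus Ivu] := uscover v x Ix Ivx.
by apply: (vPs (colon I u)) => //; rewrite mem_cat map_f.
Qed.

End Avoidance.

(** * Regular sequences in a local ring *)

Section LocalRing.
Variables (A : comNzRingType) (n : set A).
Hypothesis locA : noetherian_local n.
Implicit Types (I J K P : set A) (a b c u v w x y z : A) (s : seq A).

Lemma local_noetherian : noetherian A. Proof. by case: locA. Qed.

Let nA := local_noetherian.

Lemma max_ideal : ideal n. Proof. by case: locA => _ []. Qed.

Lemma max_ideal_proper : proper_ideal n.
Proof. by case: locA => _ [iN nT _] _; apply: proper_idealT. Qed.

Lemma proper_ideal_sub_max I : ideal I -> proper_ideal I -> I `<=` n.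
Proof.
move=> iI; elim/(noetherian_ind nA): I / iI => I iI IH I1.
have [_ _ nmax] := locA.
have [/nmax->//|notmax] := pselect (maximal_ideal I).
have IT : I <> setT by move=> IT; apply: I1; rewrite IT.
have [J [iJ [IJ [JI JT]]]] : exists J, ideal J /\ I `<=` J /\ J <> I /\ J <> setT.
  apply: contrapT => noJ; apply: notmax; split=> // J iJ IJ.
  have [|JI] := pselect (J = I); [by left|right].
  by apply: contrapT => JT; apply: noJ; exists J.
apply: (subset_trans IJ); apply: IH => //; last exact: proper_idealT.
by split=> // JI'; apply: JI; apply/seteqP.
Qed.

Lemma local_unit x : ~ n x -> exists y, y * x = 1.
Proof.
move=> nx; apply: contrapT => noy; apply: nx.
have i0 := ideal_set0 A.
apply: (@proper_ideal_sub_max (adjoin [set 0] x)); first exact: ideal_adjoin.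
- by move=> [c /eqP]; rewrite subr_eq0 => /eqP ?; apply: noy; exists c.
- exact: adjoin_self.
Qed.

Lemma ideal_nonunit I x b : ideal I -> n b -> I ((1 - b) * x) -> I x.
Proof.
move=> iI nb Ix; have [nb1|y y1] := @local_unit (1 - b).
  apply: max_ideal_proper; have -> : 1 = (1 - b) + b by ring.
  exact/(idealD max_ideal).
by rewrite -[x]mul1r -y1 -mulrA; apply: ideal_mull.
Qed.

(* A form of Nakayama's lemma for K <= I + bK that does not ask K to be an
   ideal: compare I + (x) and I + (y) when x = b y mod I. *)
Lemma nakayama I K b : ideal I -> n b ->
  (forall x, K x -> exists2 y, K y & I (x - b * y)) -> K `<=` I.
Proof.
move=> iI nb Kb.
suff h : forall L, ideal L -> forall x, L = adjoin I x -> K x -> I x.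
  by move=> x; apply: h erefl; apply: ideal_adjoin.
move=> L iL; elim/(noetherian_ind nA): L / iL => L iL IH x LE Kx.
have [y Ky Ixy] := Kb x Kx.
have Iy : I y -> I x by move=> Iy; apply: (ideal_congr iI Ixy); apply: ideal_mull.
have sub : L `<=` adjoin I y.
  rewrite LE; apply: adjoin_min; [exact: ideal_adjoin|exact: sub_adjoin|].
  by exists b.
have [[c Iyx]|nyx] := pselect (adjoin I x y); last first.
  apply/Iy/(IH (adjoin I y)) => //; first exact: ideal_adjoin.
  by split=> // /(_ y (adjoin_self y iI)); rewrite LE.
apply/Iy/(@ideal_nonunit _ _ (c * b)) => //; first exact: (ideal_mull _ max_ideal).
have -> : (1 - c * b) * y = (y - c * x) + c * (x - b * y) by ring.
by apply: idealD => //; apply: ideal_mull.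
Qed.

(** If b x is in [I], then x = a y modulo [I] with b y again in [I]; Nakayama's lemma then makes all
    such x vanish modulo [I]. *)
Lemma regular_mod_swap I a b : ideal I -> n a ->
  regular_mod I a -> regular_mod (adjoin I a) b ->
  regular_mod I b /\ regular_mod (adjoin I b) a.
Proof.
move=> iI na rega regb; have regIb : regular_mod I b.
  apply: (nakayama iI na) => x Ibx; have [y Ixy] : adjoin I a x.
    by apply: regb; apply: sub_adjoin.
  exists y; last by rewrite mulrC.
  apply: rega; have -> : a * (b * y) = b * x - b * (x - y * a) by ring.
  by apply: idealB => //; apply: ideal_mull.
split=> // x [u Iaxu]; have [y Iuy] : adjoin I a u.
  apply: regb; exists x.
  have -> : b * u - x * a = - (a * x - u * b) by ring.
  exact: idealN.
exists y; apply: rega.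
have -> : a * (x - y * b) = a * x - u * b + b * (u - y * a) by ring.
by apply: idealD => //; apply: ideal_mull.
Qed.

(** By [regular_no_socle] and [regular_ex], this holds exactly when no element of [n] is regular
    modulo the ideal [I]: it is the certificate of depth zero. *)
Definition has_socle I := exists2 u, ~ I u & forall x, n x -> I (x * u).

(** Both socles are Ext^1(A/n, A/I). In elements, u corresponds to w when b u = a w modulo [I]. *)
Lemma has_socle_swap I a b : ideal I -> n a -> n b ->
  regular_mod I a -> regular_mod I b ->
  has_socle (adjoin I a) -> has_socle (adjoin I b).
Proof.
move=> iI na nb rega regb [u Iau nu].
have [w Ibu] := nu b nb; exists w.
  move=> [c Iwc]; apply: Iau; exists c; apply: regb.
  have -> : b * (u - c * a) = b * u - w * a + a * (w - c * b) by ring.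
  by apply: idealD => //; apply: ideal_mull.
move=> x nx; have [e Ixu] := nu x nx; exists e; apply: rega.
have -> : a * (x * w - e * b) = b * (x * u - e * a) - x * (b * u - w * a) by ring.
by apply: idealB => //; apply: ideal_mull.
Qed.

Lemma regular_no_socle I v : n v -> regular_mod I v -> ~ has_socle I.
Proof. by move=> nv reg [u Iu nu]; apply/Iu/reg/nu. Qed.

Lemma regular_ex (Is : seq (set A)) :
  {in Is, forall I, ideal I /\ ~ has_socle I} ->
  exists2 v, n v & {in Is, forall I, regular_mod I v}.
Proof.
move=> hIs.
have [|v + vreg] := regular_avoidance nA (Is := Is) (J := n) (a := 0) max_ideal.
  move=> I /hIs[iI soc]; split=> // u _ nu; apply: contrapT => Iu; apply: soc.
  by exists u.
by rewrite subr0 => nv; exists v.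
Qed.

Fixpoint depth_ge k I : Prop :=
  if k is k'.+1 then exists v, [/\ n v, regular_mod I v & depth_ge k' (adjoin I v)]
  else True.

(** Independence of depth from the regular element chosen. The given [v] and the witness [v'] are
    linked by a [u] regular modulo both I + (v) and I + (v'), which exists because the socles vanish
    together; after swapping, induction passes from I + (v') to I + (u), and from there to I + (v,
    u). *)
Lemma depth_ge_adjoin k I v : ideal I -> n v -> regular_mod I v ->
  depth_ge k.+1 I -> depth_ge k (adjoin I v).
Proof.
elim: k I v => [//|k IH] I v iI nv regv [v' [nv' regv' depv']].
have iIv := ideal_adjoin v iI; have iIv' := ideal_adjoin v' iI.
have socv' : ~ has_socle (adjoin I v').
  by case: depv' => u [nu + _]; apply: regular_no_socle.
have socv : ~ has_socle (adjoin I v).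
  by move=> soc; apply: socv'; apply: (has_socle_swap _ nv nv').
have [J|u nu ureg] := @regular_ex [:: adjoin I v; adjoin I v'].
  by rewrite !inE => /orP[]/eqP->.
have [_ regv'u] := regular_mod_swap iI nv' regv' (ureg _ (mem_last _ _)).
have [regu regvu] := regular_mod_swap iI nv regv (ureg _ (mem_head _ _)).
have iIu := ideal_adjoin u iI.
exists u; split=> //; first by apply: ureg; rewrite mem_head.
rewrite adjoinC //; apply: (IH) => //; exists v'; split=> //.
by rewrite -adjoinC //; apply: IH => //; apply: ureg; rewrite !inE eqxx orbT.
Qed.

Fixpoint regular_seq I s : Prop :=
  if s is a :: s' then [/\ n a, regular_mod I a & regular_seq (adjoin I a) s']
  else True.

Lemma regular_seq_cat I s1 s2 :
  regular_seq I (s1 ++ s2) <-> regular_seq I s1 /\ regular_seq (adjoin_seq I s1) s2.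
Proof.
elim: s1 I => [|a s1 IH] I /=; first by split=> [|[]].
by split=> [[na ra /IH[]]|[[na ra r1] r2]]; [|split=> //; apply/IH].
Qed.

Lemma regular_seq_sub I s : regular_seq I s -> {in s, forall x, n x}.
Proof.
elim: s I => //= a s IH I [na _ /IH sn] x; rewrite inE => /predU1P[->//|].
exact: sn.
Qed.

Lemma regular_seq_depth_ge I s : regular_seq I s -> depth_ge (size s) I.
Proof. by elim: s I => //= a s IH I [na ra /IH ?]; exists a. Qed.

Lemma depth_ge_adjoin_seq k I s : ideal I -> regular_seq I s ->
  depth_ge (size s + k) I -> depth_ge k (adjoin_seq I s).
Proof.
elim: s I => //= a s IH I iI [na ra rs] dep.
by apply: IH => //; [exact: ideal_adjoin|exact: depth_ge_adjoin].
Qed.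

Lemma maximal_regular_seq I : ideal I -> proper_ideal I ->
  exists s, regular_seq I s /\ has_socle (adjoin_seq I s).
Proof.
move=> iI; elim/(noetherian_ind nA): I / iI => I iI IH I1.
have [soc|soc] := pselect (has_socle I); first by exists [::].
have [J|v nv vreg] := @regular_ex [:: I]; first by rewrite inE => /eqP->.
have ra := vreg I (mem_head _ _); have iIv := ideal_adjoin v iI.
have Iv1 : proper_ideal (adjoin I v).
  move=> Iv1; apply: max_ideal_proper; apply: adjoin_min Iv1 => //.
    exact: max_ideal.
  exact: proper_ideal_sub_max.
have [|//|s [rs soc']] := IH _ iIv.
  split; first exact: sub_adjoin.
  (* The ideal grows strictly: a regular [v] lying in [I] would kill the class of 1. *)
  by move=> /(_ v (adjoin_self v iI)) Iv; apply/I1/ra; rewrite mulr1.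
by exists (v :: s).
Qed.

(* Each parameter is corrected by an element of the span of the later ones so
   as to avoid the maximal annihilators; this leaves the total span unchanged. *)
Lemma regular_seq_of_params I s : ideal I -> n `<=` radical (adjoin_seq I s) ->
  {in s, forall x, n x} -> depth_ge (size s) I ->
  exists2 s', regular_seq I s' &
    forall J, ideal J -> adjoin_seq J s' = adjoin_seq J s.
Proof.
elim: s I => [|a s IH] I iI rad sn dep; first by exists [::].
have [v0 [nv0 rv0 _]] := dep; have i0 := ideal_set0 A.
(* The correction is taken in the ideal generated by [s] alone, so that it is absorbed over every
   base ideal [J] and not only over [I]. *)
pose J0 := adjoin_seq [set 0] s.
have iJ0 : ideal J0 by exact: ideal_adjoin_seq.
have absorb J v : ideal J -> J0 (v - a) ->
    adjoin_seq (adjoin J v) s = adjoin_seq (adjoin J a) s.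
  move=> iJ J0v; rewrite !adjoin_seq_adjoin //.
  have iJs := ideal_adjoin_seq s iJ.
  have Jva : adjoin_seq J s (v - a).
    by apply: adjoin_seqS J0v => _ ->; apply: ideal0.
  apply/seteqP; split; apply: adjoin_min; try exact: ideal_adjoin;
    try exact: sub_adjoin.
    exists 1; rewrite mul1r //.
  exists 1; rewrite mul1r -opprB; exact: idealN.
have [I'|v J0v vreg] := regular_avoidance nA (Is := [:: I]) (a := a) iJ0.
  rewrite inE => /eqP->; split=> // u Iau J0u; apply: contrapT => Iu.
  (* The prime [colon I w] contains [I], [a] and [s], hence all of [n], including the regular
     element [v0]: a contradiction. *)
  have [w wmax uw] := max_annihilator_ex nA iI Iu.
  have radP : n `<=` colon I w.
    apply: (subset_trans rad); apply: prime_radical; first exact: max_annihilator_prime.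
    apply: adjoin_seq_min => [||y]; [exact: ideal_colon|exact: sub_colon|].
    rewrite inE => /predU1P[->|ys]; first exact: uw.
    exact/uw/J0u/adjoin_seq_self.
  have [Iw _] := wmax; apply: Iw; apply: rv0; exact: radP.
have nv : n v.
  have -> : v = (v - a) + a by ring.
  apply: idealD; [exact: max_ideal| |by apply: sn; rewrite mem_head].
  apply: adjoin_seq_min J0v; [exact: max_ideal| |].
    by move=> _ ->; exact: (ideal0 max_ideal).
  by move=> x xs; apply: sn; rewrite inE xs orbT.
have rv := vreg I (mem_head _ _).
have [||||s' rs' s'E] := IH (adjoin I v).
- exact: ideal_adjoin.
- by rewrite absorb.
- by move=> x xs; apply: sn; rewrite inE xs orbT.
- exact: depth_ge_adjoin.
exists (v :: s') => // J iJ /=.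
by rewrite s'E ?absorb //; apply: ideal_adjoin.
Qed.

End LocalRing.

(** * Chains of primes and dimension *)

Section Quotients.
Variables (A : pzRingType) (M : lmodType A) (X : set M).
Implicit Types x y : M.

Lemma quotmod_pi0 : \pi_(quotmod X) 0 = 0.
Proof. by apply: (addIr (\pi_(quotmod X) 0)); rewrite -quotmod_piD !add0r. Qed.

Lemma quotmod_pi_eq0 x : \pi_(quotmod X) x = 0 <-> submod_gen X x.
Proof. by rewrite -quotmod_pi0 quotmod_eqP subr0. Qed.

Lemma quotmod_piZ a x : \pi_(quotmod X) (a *: x) = a *: \pi_(quotmod X) x.
Proof. by rewrite -quotmod_scale_pi. Qed.

End Quotients.

Section Primes.
Variable A : comNzRingType.
Hypothesis nA : noetherian A.
Implicit Types (I P Q W : set A) (x y : A).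

(** If [I] cannot be enlarged without meeting [W], it is prime: for x, y outside [I] with x y in
    [I], elements of [W] in I + (x) and I + (y) have a product in both [I] and [W]. *)
Lemma prime_disjoint_ex I W : ideal I -> W 1 ->
  (forall x y, W x -> W y -> W (x * y)) -> (forall x, I x -> ~ W x) ->
  exists Q, [/\ prime_ideal Q, I `<=` Q & forall x, Q x -> ~ W x].
Proof.
move=> + W1 WM; move: I; apply: (noetherian_ind nA) => I iI IH IW.
have larger x : ~ I x -> (forall y, adjoin I x y -> ~ W y) ->
    exists Q, [/\ prime_ideal Q, I `<=` Q & forall y, Q y -> ~ W y].
  move=> Ix xW; have [||Q [pQ IQ QW]] := IH (adjoin I x) _ _ xW.
  - exact: ideal_adjoin.
  - by split; [apply: sub_adjoin|move=> /(_ x (adjoin_self x iI))].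
  by exists Q; split=> //; apply: subset_trans IQ; apply: sub_adjoin.
apply: contrapT => noQ; have meetW x : ~ I x -> exists2 y, adjoin I x y & W y.
  move=> Ix; apply: contrapT => noy; apply/noQ/(larger x Ix) => y Iy Wy.
  by apply: noy; exists y.
apply: noQ; exists I; split=> //; split=> // [IT|x y Ixy].
  by apply: (IW 1) => //; rewrite IT.
have [|Ix] := pselect (I x); [by left|right]; apply: contrapT => Iy.
have [v [c Ivc] Wv] := meetW x Ix; have [w [d Iwd] Ww] := meetW y Iy.
apply: (IW (v * w)); last exact: WM.
have -> : v * w = w * (v - c * x) + c * x * (w - d * y) + c * d * (x * y) by ring.
by do !apply: idealD => //; apply: ideal_mull.
Qed.

Lemma not_radical_prime I x : ideal I -> ~ radical I x ->
  exists Q, [/\ prime_ideal Q, I `<=` Q & ~ Q x].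
Proof.
move=> iI radx.
have [|||Q [pQ IQ QW]] := @prime_disjoint_ex _ [set y | exists k, y = x ^+ k] iI.
- by exists 0%N.
- by move=> _ _ [k ->] [l ->]; exists (k + l)%N; rewrite exprD.
- by move=> y Iy [k yE]; apply: radx; exists k; rewrite /= -yE.
by exists Q; split=> // Qx; apply: (QW x Qx); exists 1%N.
Qed.

End Primes.

Section PrimeChains.
Variables (A : comNzRingType) (n : set A).
Hypothesis locA : noetherian_local n.
Implicit Types (I J P Q : set A) (x y : A) (s : seq A).

Let nA := local_noetherian locA.

Definition prime_chain_along k (C : nat -> set A) :=
  (forall i, (i <= k)%N -> prime_ideal (C i)) /\
  (forall i, (i < k)%N -> C i `<` C i.+1).

(* A nonzerodivisor modulo I lies in no minimal prime of I, so each term of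
   the regular sequence lets the chain be extended downwards by one prime. *)
Lemma regular_seq_prime_chain I s k C : ideal I -> regular_seq n I s ->
  prime_chain_along k C -> adjoin_seq I s `<=` C 0%N ->
  exists2 C', prime_chain_along (size s + k) C' & I `<=` C' 0%N.
Proof.
elim: s I => [|a s IH] I iI /=; first by exists C.
move=> [na ra rs] chP sP.
have [C' chP' IP'] := IH _ (ideal_adjoin a iI) rs chP sP.
have pP0 : prime_ideal (C' 0%N) by apply: chP'.1.
have [iP0 P0T mP0] := pP0; have P01 := proper_idealT iP0 P0T.
(* A prime disjoint from [W] lies inside [C' 0] and misses [a]. Regularity of [a] modulo [I] strips
   the power of [a], so [I] is disjoint from [W]. *)
pose W x := exists j u, ~ C' 0%N u /\ x = a ^+ j * u.
have [||||Q [pQ IQ QW]] := @prime_disjoint_ex _ nA I W.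
- exact: iI.
- by exists 0%N, 1; rewrite expr0 mulr1.
- move=> _ _ [j [u [Pu ->]]] [l [v [Pv ->]]]; exists (j + l)%N, (u * v).
  by rewrite exprD mulrACA; split=> // /mP0[].
- move=> x + [j [u [Pu xE]]]; rewrite {x}xE; elim: j => [|j IHj].
    by rewrite expr0 mul1r => /sub_adjoin/IP'.
  by rewrite exprS -mulrA => /ra.
exists (fun i => if i is i'.+1 then C' i' else Q) => //; split=> [[|i]|[|i]] //=.
- by rewrite addSn => /chP'.1.
- move=> _; split=> [x Qx|sub].
    by apply: contrapT => Px; apply: (QW x Qx); exists 0%N, x; rewrite expr0 mul1r.
  apply: (QW a); last by exists 1%N, 1; rewrite expr1 mulr1.
  exact/sub/IP'/adjoin_self.
- by rewrite addSn => /chP'.2.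
Qed.

Lemma max_ideal_prime : prime_ideal n.
Proof.
split; first exact: (max_ideal locA).
  by move=> nT; apply: (max_ideal_proper locA); rewrite nT.
move=> x y nxy; have [|nx] := pselect (n x); [by left|right].
have [z zx] := local_unit locA nx.
by rewrite -[y]mul1r -zx -mulrA; apply: (ideal_mull _ (max_ideal locA)).
Qed.

Lemma prime_sub_max P : prime_ideal P -> P `<=` n.
Proof. by move=> [iP /(proper_idealT iP) P1 _]; apply: (proper_ideal_sub_max locA). Qed.

(** A prime Q containing [s] but not all of [n] gives the chain Q < n, which the regular sequence
    extends downwards to length [size s] + 1, more than d. *)
Lemma krull_dim_radical d s : krull_dim A d -> regular_seq n [set 0] s ->
  (d <= size s)%N -> n `<=` radical (adjoin_seq [set 0] s).
Proof.
move=> [_ dmax] rs ds x nx; apply: contrapT => radx.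
have i0 := ideal_set0 A; have iI := ideal_adjoin_seq s i0.
have [Q [pQ IQ Qx]] := not_radical_prime nA iI radx.
have [|P' chP' _] := @regular_seq_prime_chain _ s 1%N
  (fun i => if i is 0%N then Q else n) i0 rs _ IQ.
  split=> [[|[]]|[]] //= _; first exact: max_ideal_prime.
  split; first exact: prime_sub_max.
  by move=> /(_ x nx).
have /dmax : prime_chain A (size s + 1) by exists P'.
by rewrite addn1 => /leq_trans/(_ ds); rewrite ltnn.
Qed.

Lemma regular_sequence_seq s : [set` s] `<=` n -> regular_sequence s ->
  regular_seq n [set 0] s.
Proof.
move=> sn [_ hs].
have {hs} : forall i, (i < size s)%N ->
    regular_mod (adjoin_seq [set 0] (take i s)) s`_i.
  move=> i si x.
  rewrite -ideal_gen_seq /ideal_gen; move/(@quotmod_pi_eq0 A A^o).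
  by rewrite (quotmod_piZ (M := A^o)) => /(hs i si)/quotmod_pi_eq0.
elim: s [set 0 : A] sn => //= a s IH I sn hs; split.
- by apply: sn; rewrite /= mem_head.
- exact: (hs 0%N).
- apply: IH => [x xs|i si]; first by apply: sn; rewrite /= inE xs orbT.
  exact: (hs i.+1).
Qed.

Lemma depth_depth_ge d : depth n d -> depth_ge n d [set 0].
Proof.
move=> [[s [<- sn /(regular_sequence_seq sn) rs]] _].
exact: regular_seq_depth_ge.
Qed.

End PrimeChains.

(** * Flatness in terms of ideals *)

Section Extension.
Variables (R S : comNzRingType) (f : {rmorphism R -> S}).
Implicit Types (I : set R) (J K : set S) (a b : R) (x y : S).

(** The ideal IS + J, so that S/(IS + J) is the base change of S/J to R/I. It is used with the flat
    map and also with iterates of an endomorphism in place of [f]. *)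
Definition ext_sum I J : set S := ideal_sum (ideal_gen (f @` I)) J.

Lemma ideal_ext_sum I J : ideal J -> ideal (ext_sum I J).
Proof. by move=> iJ; apply: ideal_ideal_sum => //; apply: ideal_gen_ideal. Qed.

Lemma ext_sum_image I J a : ideal J -> I a -> ext_sum I J (f a).
Proof.
by move=> iJ Ia; apply: sub_ideal_suml => //; apply: sub_ideal_gen; exists a.
Qed.

Lemma sub_ext_sum I J : J `<=` ext_sum I J.
Proof. exact/sub_ideal_sumr/ideal_gen_ideal. Qed.

Lemma ext_sum_min I J K : ideal K -> (forall a, I a -> K (f a)) -> J `<=` K ->
  ext_sum I J `<=` K.
Proof.
move=> iK IK JK; apply: ideal_sum_min => //.
by apply: ideal_gen_min => // _ [a Ia <-]; apply: IK.
Qed.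

Lemma ext_sumS I I' J J' : ideal J' -> I `<=` I' -> J `<=` J' ->
  ext_sum I J `<=` ext_sum I' J'.
Proof.
move=> iJ' II' JJ'; apply: ext_sum_min; first exact: ideal_ext_sum.
  by move=> a /II'; apply: ext_sum_image.
by apply: (subset_trans JJ'); apply: sub_ext_sum.
Qed.

Lemma ext_sum_adjoinl I J a : ideal I -> ideal J ->
  ext_sum (adjoin I a) J = adjoin (ext_sum I J) (f a).
Proof.
move=> iI iJ; have iE := ideal_ext_sum I iJ; apply/seteqP; split.
  apply: ext_sum_min; first exact: ideal_adjoin.
    move=> b [c Ibc]; exists (f c).
    by rewrite -rmorphM -rmorphB; apply: ext_sum_image.
  by apply: (subset_trans (@sub_ext_sum I J)); apply: sub_adjoin.
apply: adjoin_min; first exact: ideal_ext_sum.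
  by apply: ext_sumS => //; apply: sub_adjoin.
by apply: ext_sum_image => //; apply: adjoin_self.
Qed.

Lemma ext_sum_adjoin_seql I J s : ideal I -> ideal J ->
  ext_sum (adjoin_seq I s) J = adjoin_seq (ext_sum I J) (map f s).
Proof.
elim: s I => //= a s IH I iI iJ; rewrite IH //; last exact: ideal_adjoin.
by rewrite ext_sum_adjoinl.
Qed.

Lemma ext_sum_adjoinr I J x : ideal J ->
  ext_sum I (adjoin J x) = adjoin (ext_sum I J) x.
Proof. by move=> iJ; apply: ideal_sum_adjoinr => //; apply: ideal_gen_ideal. Qed.

Lemma ext_sum_adjoin_seqr I J s : ideal J ->
  ext_sum I (adjoin_seq J s) = adjoin_seq (ext_sum I J) s.
Proof. by move=> iJ; apply: ideal_sum_adjoin_seqr => //; apply: ideal_gen_ideal. Qed.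

Lemma ext_sum_colon I J a : ideal I -> ideal J ->
  ext_sum (colon I a) J `<=` colon (ext_sum I J) (f a).
Proof.
move=> iI iJ; apply: ext_sum_min.
- exact/ideal_colon/ideal_ext_sum.
- by move=> b Iba; rewrite /colon /= -rmorphM; apply: ext_sum_image.
- by move=> x Jx; apply: sub_colon; [apply: ideal_ext_sum|apply: sub_ext_sum].
Qed.

Lemma ext_sum_unit I J x : ideal J -> I 1 -> ext_sum I J x.
Proof.
move=> iJ I1; rewrite -[x]mulr1; apply: ideal_mull; first exact: ideal_ext_sum.
by rewrite -(rmorph1 f); apply: ext_sum_image.
Qed.

Lemma ext_sum0 I : ext_sum I [set 0] = ideal_gen (f @` I).
Proof.
have iG := ideal_gen_ideal (f @` I); apply/seteqP; split.
  by apply: ideal_sum_min => // _ ->; apply: (ideal0 iG).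
exact/sub_ideal_suml/ideal_set0.
Qed.

(* S/J is flat over R, tested on the inclusions (I + (a))/I of R/I. *)
Definition flat_mod J := forall I a x, ideal I ->
  ext_sum I J (f a * x) -> ext_sum (colon I a) J x.

End Extension.

Section FlatHom.
Variables (R S : comNzRingType) (f : {rmorphism R -> S}).
Implicit Types (I : set R) (a b : R) (x y : S).

Lemma quotmod_mul_ex I a : ideal I ->
  exists2 u : {linear quotmod (colon I a : set R^o) -> quotmod (I : set R^o)},
    injective u &
    forall b, u (\pi_(quotmod (colon I a : set R^o)) b) =
      \pi_(quotmod (I : set R^o)) (b * a).
Proof.
move=> iI; have iC := ideal_colon a iI.
set M := quotmod _; set M' := quotmod _.
have genI (J : set R) : ideal J -> submod_gen (J : set R^o) = J.
  exact: ideal_gen_id.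
pose g (q : M) : M' := \pi_M' (repr q * a : R^o).
have gpi b : g (\pi_M b) = \pi_M' (b * a).
  apply/quotmod_eqP; rewrite genI // -mulrBl.
  have : submod_gen (colon I a : set R^o) (repr (\pi_M b) - b).
    by apply/quotmod_eqP; rewrite reprK.
  by rewrite genI.
have glin : linear g.
  move=> c p q; rewrite -[p]reprK -[q]reprK -quotmod_piZ -quotmod_piD !gpi.
  by rewrite -quotmod_piZ -quotmod_piD mulrDl -mulrA.
pose gL := GRing.isLinear.Build _ _ _ _ g glin.
pose u : {linear M -> M'} := HB.pack g gL.
exists u => // p q; rewrite -[p]reprK -[q]reprK => /(etrans (esym (gpi _))).
rewrite [RHS]gpi => /quotmod_eqP.
by rewrite genI // -mulrBl => Ipq; apply/quotmod_eqP; rewrite genI.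
Qed.

(* The pairing R/K x S -> S/KS factors through the tensor product. *)
Lemma tensor_eq_quotmod (K : set R) 
    (t u : seq (quotmod (K : set R^o) * restrict f)) :
  ideal K -> tensor_eq t u ->
  ideal_gen (f @` K) (\sum_(p <- t) f (repr p.1 : R) * (p.2 : S)
                      - \sum_(p <- u) f (repr p.1 : R) * (p.2 : S)).
Proof.
move=> iK; have iG := ideal_gen_ideal (f @` K).
have fK a x : K a -> ideal_gen (f @` K) (f a * x).
  by move=> Ka; apply: (ideal_mulr _ iG); apply: sub_ideal_gen; exists a.
have genK : submod_gen (K : set R^o) = K by exact: ideal_gen_id.
have Kpi (b c : R) :
    \pi_(quotmod (K : set R^o)) b = \pi_(quotmod (K : set R^o)) c -> K (b - c).
  by move=> /quotmod_eqP; rewrite genK.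
elim=> {t u}.
- by move=> t; rewrite subrr; apply: (ideal0 iG).
- by move=> t u _ IH; rewrite -opprB; apply: (idealN iG).
- move=> t u v _ IH1 _ IH2.
  rewrite -[X in _ (X - _)](subrK (\sum_(p <- u) f (repr p.1 : R) * (p.2 : S))).
  by rewrite -addrA; apply: (idealD iG).
- move=> t t' u u' _ IH1 _ IH2.
  by rewrite !big_cat /= opprD addrACA; apply: (idealD iG).
- by move=> t u; rewrite !big_cat /= addrC subrr; apply: (ideal0 iG).
- move=> x; rewrite !big_cons !big_nil addr0 subr0 /=; apply: fK.
  have := Kpi (repr (0 : quotmod (K : set R^o))) 0; rewrite subr0; apply.
  by rewrite reprK quotmod_pi0.
- move=> q q' x; rewrite !big_cons !big_nil !addr0 /=.
  rewrite -mulrDl -mulrBl -rmorphD -rmorphB.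
  by apply: fK; apply: Kpi; rewrite quotmod_piD !reprK.
- move=> q x y; rewrite !big_cons !big_nil !addr0 /= mulrDr subrr; exact: (ideal0 iG).
- move=> a q x; rewrite !big_cons !big_nil !addr0 /=.
  have -> : ((a *: x : restrict f) : S) = f a * (x : S) by [].
  rewrite mulrA -mulrBl -rmorphM -rmorphB.
  by apply: fK; apply: Kpi; rewrite [_ * a]mulrC (quotmod_piZ (M := R^o)) !reprK.
Qed.

Lemma tensor_eq_ext I x : ideal I -> ideal_gen (f @` I) x ->
  @tensor_eq R (quotmod (I : set R^o)) (restrict f)
    [:: (\pi_(quotmod (I : set R^o)) (1 : R), x : restrict f)] [::].
Proof.
move=> iI; set e := \pi_ _ _.
pose K := [set z : S | forall c,
  @tensor_eq R (quotmod (I : set R^o)) (restrict f) [:: (e, c * z : restrict f)] [::]].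
suff sub : ideal_gen (f @` I) `<=` K by move=> /sub /(_ 1); rewrite mul1r.
apply: ideal_gen_min; first (apply/idealP; split).
- move=> c; rewrite mulr0.
  (* Among the relations only a zero on the left gives the empty sum, so the scalar 0 is moved
     across. *)
  have -> : (0 : restrict f) = 0 *: (0 : restrict f) by rewrite scale0r.
  apply: (tensor_trans (tensor_sym (tensor_Z _ _ _))).
  by rewrite scale0r; apply: tensor_0l.
- move=> a y z Ky Kz c; rewrite mulrDr mulrA.
  apply: (tensor_trans (tensor_Dr _ _ _)).
  exact: (tensor_cat (Ky _) (Kz _)).
- move=> _ [i Ii <-] c; rewrite mulrC.
  apply: (tensor_trans (tensor_sym (tensor_Z (N := restrict f) i e c))).
  rewrite /e -quotmod_piZ.
  have -> : \pi_(quotmod (I : set R^o)) (i *: (1 : R^o)) = 0.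
    apply/quotmod_pi_eq0; apply: sub_gen_smallest.
    by rewrite /= -[_ *: _]/(i * 1) mulr1.
  exact: tensor_0l.
Qed.

(** Multiplication by a embeds R/(I : a) in R/I and sends 1 (x) x to a (x) x = 1 (x) f(a)x = 0.
    Flatness gives 1 (x) x = 0 already over R/(I : a), which the pairing into S/(I : a)S reads as
    the claim. *)
Lemma flat_hom_colon I a x : flat_hom f -> ideal I ->
  ideal_gen (f @` I) (f a * x) -> ideal_gen (f @` colon I a) x.
Proof.
move=> flatf iI Ifax; have iC := ideal_colon a iI.
have [u uinj uE] := quotmod_mul_ex a iI.
have : @tensor_eq R (quotmod (colon I a : set R^o)) (restrict f)
    [:: (\pi_(quotmod (colon I a : set R^o)) (1 : R), x : restrict f)] [::].
  apply: (flatf _ _ u uinj); rewrite /tensor_map /= uE mul1r.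
  have -> : \pi_(quotmod (I : set R^o)) a = a *: \pi_(quotmod (I : set R^o)) (1 : R).
    by rewrite -quotmod_piZ; congr (\pi_ _ _); rewrite -[RHS]/(a * 1) mulr1.
  apply: (tensor_trans (tensor_Z _ _ _)).
  exact: tensor_eq_ext.
move=> /(tensor_eq_quotmod iC); rewrite !big_cons !big_nil addr0 subr0 /=.
have iG := ideal_gen_ideal (f @` colon I a).
apply: contraPP => notx Ix; apply: notx; apply: (ideal_congr iG _ Ix).
set e := repr _; have -> : x - f e * x = f (1 - e) * x by rewrite rmorphB rmorph1; ring.
apply: (ideal_mulr _ iG); apply: sub_ideal_gen; exists (1 - e) => //.
have : submod_gen (colon I a : set R^o) (1 - e).
  by apply/quotmod_eqP; rewrite reprK.
by have -> : submod_gen (colon I a : set R^o) = colon I a by exact: ideal_gen_id.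
Qed.

Lemma flat_hom_flat_mod : flat_hom f -> flat_mod f [set 0].
Proof.
by move=> flatf I a x iI; rewrite !ext_sum0; apply: flat_hom_colon.
Qed.

End FlatHom.

Section FlatLocal.
Variables (R S : comNzRingType) (m : set R) (n : set S) (f : {rmorphism R -> S}).
Hypotheses (locR : noetherian_local m) (locS : noetherian_local n).
Hypothesis fmn : local_hom m n f.
Implicit Types (I : set R) (J : set S) (a b : R) (w x y : S).

Let nR := local_noetherian locR.

(** Noetherian induction from the fiber I = m. For b in m outside [I], induction on I + (b) writes a
    y killed by w as f(b) z, and flatness gives w z in (I : b)S + J. If I : b is larger than [I],
    induction puts z there and f(b) z vanishes; otherwise z is again killed by w and Nakayama's
    lemma applies. *)
Lemma flat_regular_mod J w : ideal J -> flat_mod f J ->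
  regular_mod (ext_sum f m J) w ->
  forall I, ideal I -> regular_mod (ext_sum f I J) w.
Proof.
move=> iJ flatJ regw; apply: (noetherian_ind nR) => I iI IH x Iwx.
have iE := ideal_ext_sum f I iJ.
have [I1|I1] := pselect (I 1); first exact: ext_sum_unit.
have [mI|/existsNP[b /not_implyP[mb Ib]]] := pselect (m `<=` I).
  have mE : I = m.
    by apply/seteqP; split=> //; apply: (proper_ideal_sub_max locR).
  by move: Iwx; rewrite mE; apply: regw.
have iC := ideal_colon b iI.
have step y : ext_sum f I J (w * y) -> exists2 z, ext_sum f (colon I b) J (w * z)
    & ext_sum f I J (y - f b * z).
  move=> Iwy; have [z Iyz] : adjoin (ext_sum f I J) (f b) y.
    rewrite -ext_sum_adjoinl //; apply: IH; first exact: ideal_adjoin.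
      by split; [apply: sub_adjoin|move=> /(_ b (adjoin_self b iI))].
    by apply: ext_sumS Iwy => //; apply: sub_adjoin.
  exists z; last by rewrite mulrC.
  apply: flatJ => //.
  have -> : f b * (w * z) = w * y - w * (y - z * f b) by ring.
  by apply: (idealB iE) => //; apply: (ideal_mull _ iE).
have [CI|CI] := pselect (colon I b `<=` I).
  have nfb : n (f b) by apply: fmn; exists b.
  apply: (nakayama locS (K := [set y | ext_sum f I J (w * y)]) iE nfb) => //= y /step.
  by case=> z Iz Iyz; exists z => //; apply: ext_sumS Iz.
have [z Cwz Ixz] := step x Iwx.
apply: (ideal_congr iE Ixz); rewrite mulrC.
apply: (@ext_sum_colon _ _ f I J b iI iJ z).
by apply: IH => //; split=> //; apply: sub_colon.
Qed.

(** From f(a) x = u w modulo IS + J, regularity of [w] modulo (I + (a))S + J gives u = c f(a) modulo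
    IS + J; then flatness of S/J applies to x - c w. *)
Lemma flat_mod_adjoin J w : ideal J -> flat_mod f J ->
  regular_mod (ext_sum f m J) w -> flat_mod f (adjoin J w).
Proof.
move=> iJ flatJ regw I a x iI; rewrite !ext_sum_adjoinr //.
have iE := ideal_ext_sum f I iJ.
have regE := flat_regular_mod iJ flatJ regw.
move=> [u Iaxu]; have [c Iuc] : adjoin (ext_sum f I J) (f a) u.
  rewrite -ext_sum_adjoinl //; apply: regE; first exact: ideal_adjoin.
  rewrite ext_sum_adjoinl //; exists x.
  have -> : w * u - x * f a = - (f a * x - u * w) by ring.
  exact: (idealN iE).
exists c; apply: flatJ => //.
have -> : f a * (x - c * w) = f a * x - u * w + w * (u - c * f a) by ring.
by apply: (idealD iE) => //; apply: (ideal_mull _ iE).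
Qed.

Lemma flat_regular_seq J s : ideal J -> flat_mod f J ->
  regular_seq n (ext_sum f m J) s ->
  flat_mod f (adjoin_seq J s) /\
  forall I, ideal I -> regular_seq n (ext_sum f I J) s.
Proof.
elim: s J => //= w s IH J iJ flatJ [nw rw]; rewrite -ext_sum_adjoinr // => rs.
have [||flatJs rIs] := IH _ _ _ rs; [exact: ideal_adjoin|exact: flat_mod_adjoin|].
split=> // I iI; split=> //; first exact: flat_regular_mod.
by rewrite -ext_sum_adjoinr //; apply: rIs.
Qed.

Lemma regular_mod_ext I J a : ideal I -> ideal J -> flat_mod f J ->
  regular_mod I a -> regular_mod (ext_sum f I J) (f a).
Proof.
move=> iI iJ flatJ ra x Iax; have := flatJ I a x iI Iax.
by apply: ext_sumS => // b; rewrite /colon /= mulrC; apply: ra.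
Qed.

Lemma regular_seq_ext I J s : ideal I -> ideal J -> flat_mod f J ->
  regular_seq m I s -> regular_seq n (ext_sum f I J) (map f s).
Proof.
move=> + iJ flatJ; elim: s I => //= a s IH I iI [ma ra rs]; split.
- by apply: fmn; exists a.
- exact: regular_mod_ext.
- by rewrite -ext_sum_adjoinl //; apply: IH => //; apply: ideal_adjoin.
Qed.

(* If u and v span the socles of R/I and of S/(mS + J), then f(u)v is killed
   by n modulo IS + J, and it is nonzero there because IS + J : f(u) = mS + J. *)
Lemma has_socle_ext I J : ideal I -> ideal J -> flat_mod f J ->
  has_socle m I -> has_socle n (ext_sum f m J) -> has_socle n (ext_sum f I J).
Proof.
move=> iI iJ flatJ [u Iu mu] [v Ev nv].
have iC := ideal_colon u iI.
have Cm : colon I u `<=` m.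
  by apply: (proper_ideal_sub_max locR) => //; rewrite /proper_ideal /colon /= mul1r.
exists (f u * v) => [Iuv|x nx].
  by apply: Ev; apply: (ext_sumS iJ Cm (@subset_refl _ J)); apply: flatJ.
rewrite mulrCA mulrC; apply: (@ext_sum_colon _ _ f I J u iI iJ).
exact: (ext_sumS iJ mu (@subset_refl _ J) (nv x nx)).
Qed.

Lemma cohen_macaulay_fiber_params : flat_hom f -> cohen_macaulay n ->
  exists ys : seq S, regular_seq n (ext_sum f m [set 0]) ys /\
    n `<=` radical (adjoin_seq (ext_sum f m [set 0]) ys).
Proof.
move=> flatf [d [dimS /depth_depth_ge depS]].
have i0S := ideal_set0 S; have i0R := ideal_set0 R.
have iE := ideal_ext_sum f m i0S.
have E1 : proper_ideal (ext_sum f m [set 0]).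
  move=> E1; apply: (max_ideal_proper locS); apply: ext_sum_min E1.
  - exact: max_ideal.
  - by move=> a ma; apply: fmn; exists a.
  - by move=> _ ->; apply: ideal0 (max_ideal locS).
have [ys [rys socys]] := maximal_regular_seq locS iE E1.
have R01 : proper_ideal [set 0 : R] by move=> /eqP; rewrite oner_eq0.
have [xs [rxs socxs]] := maximal_regular_seq locR i0R R01.
have flat0 := flat_hom_flat_mod flatf.
have [flatJ rIys] := flat_regular_seq i0S flat0 rys.
set J := adjoin_seq [set 0] ys in flatJ.
have iJ : ideal J by exact: ideal_adjoin_seq.
have ext0 K : ideal K -> ext_sum f [set 0] K = K.
  move=> iK; apply/seteqP; split; last exact: sub_ext_sum.
  by apply: ext_sum_min => // _ ->; rewrite rmorph0; apply: ideal0.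
have rys0 : regular_seq n [set 0] ys by rewrite -(ext0 _ i0S); apply: rIys.
have rxsJ : regular_seq n J (map f xs).
  by rewrite -(ext0 _ iJ); apply: regular_seq_ext.
pose zs := ys ++ map f xs.
have zsE : adjoin_seq [set 0] zs = ext_sum f (adjoin_seq [set 0] xs) J.
  by rewrite adjoin_seq_cat ext_sum_adjoin_seql // ext0.
have rzs : regular_seq n [set 0] zs by apply/regular_seq_cat.
have soczs : has_socle n (adjoin_seq [set 0] zs).
  rewrite zsE; apply: has_socle_ext => //; first exact: ideal_adjoin_seq.
  by rewrite ext_sum_adjoin_seqr.
(* Were [zs] shorter than the depth, independence of depth from choices would leave an element
   regular modulo [zs], which the socle forbids. *)
have dzs : (d <= size zs)%N.
  rewrite leqNgt; apply/negP => ltd; move: depS.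
  rewrite -(subnKC ltd) addSnnS => /(depth_ge_adjoin_seq locS i0S rzs)[v [nv rv _]].
  exact: regular_no_socle nv rv soczs.
exists ys; split=> // x /(krull_dim_radical locS dimS rzs dzs)[k zsxk].
exists k; rewrite -ext_sum_adjoin_seqr //.
move: zsxk; rewrite zsE; apply: ext_sumS => //; apply: adjoin_seq_min.
- exact: max_ideal.
- by move=> _ ->; apply: ideal0 (max_ideal locR).
- exact: regular_seq_sub rxs.
Qed.

End FlatLocal.

(** * Length *)

Section Colength.
Variables (A : comNzRingType) (n : set A).
Implicit Types (I J K : set A) (a b c x : A).

(* A composition series of A/I with l factors A/n, built upwards from I by
   adding one socle element at a time. *)
Inductive colength : set A -> nat -> Prop :=
| colength_setT : colength setT 0
| colength_step I a l : ideal I -> ~ I a -> (forall x, n x -> I (x * a)) ->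
    colength (adjoin I a) l -> colength I l.+1.

(** Additivity along 0 -> A/(I : b) -> A/I -> A/(I + (b)) -> 0: the socle elements adjoined to I : b
    are multiplied by [b]. *)
Lemma colength_colon I b k l : ideal I ->
  colength (colon I b) k -> colength (adjoin I b) l -> colength I (k + l).
Proof.
move=> iI; move CE: (colon I b) => C colC; move: I iI CE.
elim: {C k} colC => [I iI CE|C a k iC Ca na _ IH I iI CE] colb.
  have Ib : I b by have : colon I b 1; [rewrite CE|rewrite /colon /= mul1r].
  by rewrite -(adjoin_id iI Ib).
rewrite addSn; apply: (@colength_step _ (a * b)) => //.
- by move=> Iab; apply: Ca; rewrite -CE.
- by move=> x /na; rewrite -CE /colon /= mulrA.
apply: IH; first exact: ideal_adjoin.
- rewrite -CE; apply/seteqP; split=> x [c Ixc]; exists c; move: Ixc.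
    by rewrite /colon /= mulrBl mulrA.
  by rewrite /colon /= mulrBl mulrA.
- rewrite adjoinC // [adjoin (adjoin I b) _]adjoin_id //; first exact: ideal_adjoin.
  by exists a; rewrite subrr; apply: ideal0.
Qed.

Lemma colength_gt0 I l : proper_ideal I -> colength I l -> (0 < l)%N.
Proof. by move=> + colI; case: colI => // /(_ Logic.I). Qed.

Hypothesis locA : noetherian_local n.

Lemma colength_lt K K' l : ideal K' -> K `<` K' -> colength K l ->
  exists2 l', (l' < l)%N & colength K' l'.
Proof.
move=> + + colK.
elim: colK K' => {K l} [K' _ [_ /(_ _)[]]|K a l iK Ka na colKa IH K' iK'] //.
move=> [KK' K'K].
have [K'a|K'a] := pselect (K' a).
  have KaK' : adjoin K a `<=` K' by exact: adjoin_min.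
  have [K'Ka|K'Ka] := pselect (K' `<=` adjoin K a).
    by exists l => //; have -> : K' = adjoin K a by apply/seteqP.
  by have [||l' ll' colK'] := IH K'; [|split|exists l' => //; apply: ltnW].
have [||l' ll' colK'a] := IH (adjoin K' a); first exact: ideal_adjoin.
  split; first exact: adjoinS.
  (* Modulo [K], x = c a. If c is in [n], then c a and x are in [K]; if c is a unit, then [a] is in
     [K']. *)
  move=> sub; apply: K'K => x K'x; have [c Kxc] := sub _ (sub_adjoin a K'x).
  have [nc|nc] := pselect (n c); first exact: ideal_congr Kxc (na c nc).
  have [d dc] := local_unit locA nc; case: K'a; rewrite -[a]mul1r -dc -mulrA.
  apply: ideal_mull => //; have -> : c * a = x - (x - c * a) by ring.
  by apply: idealB => //; apply: KK'.
exists l'.+1 => //; apply: (@colength_step _ a) => // x nx.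
exact/KK'/na.
Qed.

Lemma colength_le K K' l : ideal K' -> K `<=` K' -> colength K l ->
  exists2 l', (l' <= l)%N & colength K' l'.
Proof.
move=> iK' KK' colK; have [K'K|K'K] := pselect (K' `<=` K).
  by exists l => //; have -> : K' = K by apply/seteqP.
by have [|l' /ltnW ll' colK'] := colength_lt iK' _ colK; [split|exists l'].
Qed.

(** A maximal annihilator modulo [I] is a prime containing [I], hence all of [n], so its element is
    in the socle and can be adjoined. *)
Lemma colength_ex I : ideal I -> n `<=` radical I -> exists l, colength I l.
Proof.
move: I; apply: (noetherian_ind (local_noetherian locA)) => I iI IH rad.
have [I1|I1] := pselect (I 1).
  by exists 0%N; rewrite (ideal1 iI I1); apply: colength_setT.
have [u umax _] := max_annihilator_ex (local_noetherian locA) iI I1.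
have pP := max_annihilator_prime iI umax.
have sub := subset_trans rad (prime_radical pP (sub_colon u iI)).
have [Iu _] := umax.
have [|||l coll] := IH (adjoin I u); first exact: ideal_adjoin.
- by split; [apply: sub_adjoin|move=> /(_ u (adjoin_self u iI))].
- by move=> x /rad[k xk]; exists k; apply: sub_adjoin.
by exists l.+1; apply: colength_step coll.
Qed.

Definition ideal_chain k (N : nat -> set A) :=
  (forall i, (i <= k)%N -> ideal (N i)) /\ (forall i, (i < k)%N -> N i `<` N i.+1).

Lemma colength_chain_le I l k N : colength I l -> ideal_chain k N -> I `<=` N 0%N ->
  (k <= l)%N.
Proof.
move=> colI [iN ltN] IN.
suff [l' + _] : exists2 l', (l' + k <= l)%N & colength (N k) l'.
  by apply: leq_trans; apply: leq_addl.
elim: k iN ltN => [|k IH] iN ltN.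
  by have [l' ll' ?] := colength_le (iN 0%N isT) IN colI; exists l'; rewrite ?addn0.
have [||l' ll' colk] := IH.
- by move=> i ik; apply/iN/leqW.
- by move=> i ik; apply/ltN/leqW.
have [l'' l''l' colk1] := colength_lt (iN _ (leqnn _)) (ltN _ (leqnn _)) colk.
by exists l'' => //; rewrite addnS -addSn (leq_trans _ ll') // leq_add2r.
Qed.

Lemma colength_chain_ex I l : colength I l ->
  exists2 N, ideal_chain l N & I `<=` N 0%N.
Proof.
elim=> {I l} [|I a l iI Ia na _ [N [iN ltN] IN]].
  exists (fun _ => setT) => //; split=> // i _; exact: ideal_setT.
exists (fun i => if i is i'.+1 then N i' else I) => //.
split=> [[|i]|[|i]] //=; [exact: iN| |exact: ltN].
move=> _; split; first exact: subset_trans (@sub_adjoin _ I a) IN.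
by move=> /(_ a) /(_ (IN _ (adjoin_self a iI))).
Qed.

Lemma colength_uniq I k l : colength I k -> colength I l -> k = l.
Proof.
move=> colk coll; apply/eqP; rewrite eqn_leq.
have [N chN IN] := colength_chain_ex colk.
have [N' chN' IN'] := colength_chain_ex coll.
by rewrite (colength_chain_le coll chN IN) (colength_chain_le colk chN' IN').
Qed.

(** The acting ring [B] may be a quotient of A because the entropy of the induced map counts lengths
    over S/mS, whereas colengths are taken in S. *)
Lemma submodule_chain_ideal_chain (B : pzRingType) (Q : lmodType B) (g : A -> B)
    (p : A -> Q) (l : nat) :
  (forall r : B, exists a, g a = r) -> (forall q, exists x, p x = q) ->
  (forall x y, p (x + y) = p x + p y) -> (forall a x, p (a * x) = g a *: p x) ->
  submodule_chain Q l <->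
  exists2 N, ideal_chain l N & [set x | p x = 0] `<=` N 0%N.
Proof.
move=> gsurj psurj pD pM.
have p0 : p 0 = 0 by apply: (addIr (p 0)); rewrite -pD !add0r.
have pB x y : p (x - y) = p x - p y.
  by apply: (addIr (p y)); rewrite -pD !subrK.
split=> [[N [sN ltN]]|[N [iN ltN] kerN]].
  exists (fun i => p @^-1` N i) => [|x /= ->]; last first.
    by have [/set_mem] := sN 0%N isT.
  split=> [i /sN[/set_mem N0 NL]|i /ltN[NN' N'N]].
    apply/idealP; split=> [|a x y Nx Ny]; rewrite /preimage /= ?p0 //.
    by rewrite pD pM; apply/set_mem/NL; apply/mem_set.
  split=> [x /NN'//|sub]; apply: N'N => q; have [x <-] := psurj q.
  exact: sub.
have kerNi i : (i <= l)%N -> [set x | p x = 0] `<=` N i.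
  elim: i => // i IH il; apply: subset_trans (IH (ltnW il)) _.
  by case: (ltN i il).
exists (fun i => p @` N i); split=> [i il|i il].
  have iNi := iN i il; split=> [|b u v /set_mem[x Nx <-] /set_mem[y Ny <-]].
    by apply/mem_set; exists 0 => //; apply: ideal0.
  have [a <-] := gsurj b; apply/mem_set; exists (a * x + y); last by rewrite pD pM.
  by apply: idealD => //; apply: ideal_mull.
have [NN' N'N] := ltN i il; split=> [_ [x /NN' N'x <-]|sub]; first by exists x.
apply: N'N => x N'x; have [y Ny pyx] := sub (p x) (imageP p N'x).
apply: (ideal_congr (iN i (ltnW il)) _ Ny).
by apply: (kerNi i (ltnW il)); rewrite /= pB pyx subrr.
Qed.

Lemma module_length_colength (F : realType) (B : pzRingType) (Q : lmodType B)
    (g : A -> B) (p : A -> Q) (l : nat) :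
  (forall r : B, exists a, g a = r) -> (forall q, exists x, p x = q) ->
  (forall x y, p (x + y) = p x + p y) -> (forall a x, p (a * x) = g a *: p x) ->
  colength [set x | p x = 0] l -> module_length F Q = l%:R%:E.
Proof.
move=> gsurj psurj pD pM coll.
have chainE k := submodule_chain_ideal_chain k gsurj psurj pD pM.
apply/le_anti/andP; split.
  apply: ge_ereal_sup => _ [k /chainE[N chN kerN] <-].
  by rewrite lee_fin ler_nat (colength_chain_le coll chN kerN).
apply: ereal_sup_ubound; exists l => //.
exact/chainE/colength_chain_ex.
Qed.

End Colength.

(** * Length of extended ideals *)

Section BaseChange.
Variables (A B : comNzRingType) (m : set A) (n : set B) (g : {rmorphism A -> B}).
Hypotheses (locA : noetherian_local m) (locB : noetherian_local n).
Implicit Types (I : set A) (J : set B).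

(** Each of the [k] factors A/m of A/I contributes a quotient of B/(mB + J). *)
Lemma colength_ext_le I J k c : ideal J -> colength m I k ->
  colength n (ext_sum g m J) c ->
  exists2 l, (l <= k * c)%N & colength n (ext_sum g I J) l.
Proof.
move=> iJ + colc; elim=> {I k} [|I a k iI Ia ma _ [l lkc coll]].
  exists 0%N => //; have -> : ext_sum g setT J = setT; last exact: colength_setT.
  by apply: ideal1; [apply: ideal_ext_sum|apply: ext_sum_unit].
have iE := ideal_ext_sum g I iJ.
have [|c' c'c colc'] := colength_le locB (ideal_colon (g a) iE) _ colc.
  apply: ext_sum_min; first exact: ideal_colon.
    by move=> b /ma; rewrite /colon /= -rmorphM; apply: ext_sum_image.
  by apply: subset_trans (sub_colon (g a) iE); apply: sub_ext_sum.
exists (c' + l)%N; first by rewrite mulSn leq_add.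
by apply: colength_colon colc' _ => //; rewrite -ext_sum_adjoinl.
Qed.

Lemma colength_ext_flat I J k c : ideal J -> flat_mod g J -> colength m I k ->
  colength n (ext_sum g m J) c -> colength n (ext_sum g I J) (k * c).
Proof.
move=> iJ flatJ + colc; elim=> {I k} [|I a k iI Ia ma _ coll].
  have -> : ext_sum g setT J = setT; last exact: colength_setT.
  by apply: ideal1; [apply: ideal_ext_sum|apply: ext_sum_unit].
rewrite mulSn; apply: (colength_colon (b := g a)); first exact: ideal_ext_sum.
  (* Flatness makes each factor exactly B/(mB + J), whence equality of lengths. *)
  suff -> : colon (ext_sum g I J) (g a) = ext_sum g m J by [].
  have iC := ideal_colon a iI; apply/seteqP; split=> [x|].
    rewrite /colon /= mulrC => /(flatJ I a x iI); apply: ext_sumS => //.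
    by apply: (proper_ideal_sub_max locA); rewrite /proper_ideal /colon /= ?mul1r.
  apply: subset_trans (@ext_sum_colon _ _ g I J a iI iJ).
  by apply: ext_sumS => // b /ma.
by rewrite -ext_sum_adjoinl.
Qed.

End BaseChange.

(** * Growth rates *)

Section Growth.
Variable F : realType.
Implicit Types (u e : nat -> F) (M : F).

Lemma bounded_mean_cvg0 e M : (forall k, `|e k| <= M) ->
  (fun k => k%:R^-1 * e k) @ \oo --> (0 : F).
Proof.
move=> eM; apply/cvgr0Pnorm_le => eps eps0.
near=> k; have k0 : 0 < k%:R :> F by rewrite ltr0n; near: k; exact: nbhs_infty_gt.
rewrite normrM normfV normr_nat mulrC ler_pdivrMr // (le_trans (eM k)) //.
rewrite mulrC -ler_pdivrMr //; near: k; exact: nbhs_infty_ger.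
Unshelve. all: by end_near. Qed.

Lemma subadditive_mul_le u k q r : (forall p q, u (p + q)%N <= u p + u q) ->
  u (q * k + r)%N <= q%:R * u k + u r.
Proof.
move=> usub; elim: q => [|q IH]; first by rewrite mul0n mul0r !add0r.
rewrite mulSn -addnA (le_trans (usub _ _)) // -natr1.
by move: IH; lra.
Qed.

Lemma fekete u : (forall k, 0 <= u k) -> (forall p q, u (p + q)%N <= u p + u q) ->
  cvgn (fun k => k%:R^-1 * u k).
Proof.
(* The index starts at 1: with 0^-1 = 0 the term at 0 is 0 and would spoil the infimum. *)
move=> u0 usub; pose E := [set k.+1%:R^-1 * u k.+1 | k in [set: nat]].
have lbE : lbound E 0 by move=> _ [k _ <-]; rewrite mulr_ge0 ?invr_ge0.
have infE : has_inf E by split; [exists (1^-1 * u 1%N), 0%N|exists 0].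
suff cv : (fun k => k%:R^-1 * u k) @ \oo --> inf E by apply/cvg_ex; exists (inf E).
apply/cvgrPdist_le => eps eps0.
have eps20 : 0 < eps / 2 by rewrite divr_gt0.
have [_ [k _ <-] ukE] := inf_adherent eps20 infE.
pose M := \sum_(r < k.+1) u r.
have uM r : (r < k.+1)%N -> u r <= M.
  by move=> rk; rewrite /M (bigD1 (Ordinal rk)) //= lerDl sumr_ge0.
near=> l; have l0 : 0 < l%:R :> F by rewrite ltr0n; near: l; exact: nbhs_infty_gt.
have lM : M / (eps / 2) <= l%:R by near: l; exact: nbhs_infty_ger.
have infl : inf E <= l%:R^-1 * u l.
  apply: ge_inf; first by exists 0.
  by exists l.-1 => //; rewrite prednK // -(ltr0n F).
suff : l%:R^-1 * u l <= inf E + eps by rewrite ler_norml; lra.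
have ul : u l <= (l %/ k.+1)%:R * u k.+1 + M.
  rewrite {1}(divn_eq l k.+1); apply: (le_trans (subadditive_mul_le _ _ _ usub)).
  by rewrite lerD2l uM // ltn_pmod.
have ql : (l %/ k.+1)%:R * u k.+1 <= l%:R * (k.+1%:R^-1 * u k.+1).
  rewrite mulrA ler_wpM2r // ler_pdivlMr // -natrM ler_nat; exact: leq_divM.
have Ml : M <= l%:R * (eps / 2) by rewrite -ler_pdivrMr.
rewrite mulrC ler_pdivrMr //; set t := k.+1%:R^-1 * u k.+1 in ukE ql.
have : l%:R * t <= l%:R * (inf E + eps / 2) by rewrite ler_pM2l // ltW.
by move: ul ql Ml; set z := _ * u k.+1; rewrite !mulrDr !mulrDl; lra.
Unshelve. all: by end_near. Qed.

(** Fekete's lemma gives the rates of b and c; that of a follows because ln a - ln b - ln c stays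
    between -ln d and ln d. *)
Lemma growth_rate_add (a b c : nat -> nat) (d : nat) :
  (0 < d)%N -> (forall k, [/\ 0 < a k, 0 < b k & 0 < c k]%N) ->
  (forall p q, (b (p + q) <= b p * b q)%N) ->
  (forall p q, (c (p + q) <= c p * c q)%N) ->
  (forall k, (a k <= d * (b k * c k))%N) -> (forall k, (b k * c k <= d * a k)%N) ->
  limn (fun k => k%:R^-1 * ln (a k)%:R : F) =
  limn (fun k => k%:R^-1 * ln (b k)%:R : F) +
  limn (fun k => k%:R^-1 * ln (c k)%:R : F).
Proof.
move=> d0 pos bsub csub abc bca.
have lnn (x : nat -> nat) k : (0 < x k)%N -> 0 <= ln (x k)%:R :> F.
  by move=> xk; rewrite ln_ge0 // ler1n.
have posr x : (0 < x)%N -> (x%:R : F) \is Num.pos by rewrite posrE ltr0n.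
have lnsub (x : nat -> nat) : (forall k, 0 < x k)%N ->
    (forall p q, (x (p + q) <= x p * x q)%N) ->
    cvgn (fun k => k%:R^-1 * ln (x k)%:R : F).
  move=> x0 xsub; apply: fekete => [k|p q]; first exact: lnn.
  by rewrite -lnM ?posr // -natrM ler_ln ?posr ?muln_gt0 ?x0 // ler_nat.
have cb := lnsub b (fun k => let: And3 _ h _ := pos k in h) bsub.
have cc := lnsub c (fun k => let: And3 _ _ h := pos k in h) csub.
pose e k : F := ln (a k)%:R - ln (b k)%:R - ln (c k)%:R.
have ce : (fun k => k%:R^-1 * e k) @ \oo --> (0 : F).
  apply: (@bounded_mean_cvg0 _ (ln d%:R)) => k; have [ak bk ck] := pos k.
  have := abc k; rewrite -(ler_nat F) -ler_ln ?posr ?muln_gt0 ?d0 ?bk //.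
  rewrite !natrM !lnM ?posr // ?rpredM ?posr // => le1.
  have := bca k; rewrite -(ler_nat F) -ler_ln ?posr ?muln_gt0 ?d0 ?bk //.
  rewrite !natrM !lnM ?posr // => le2.
  by rewrite /e ler_norml; move: le1 le2; lra.
apply: cvg_lim => //; rewrite -[X in _ --> X]addr0.
have -> : (fun k => k%:R^-1 * ln (a k)%:R : F) =
    (fun k => k%:R^-1 * ln (b k)%:R) \+ (fun k => k%:R^-1 * ln (c k)%:R) \+
    (fun k => k%:R^-1 * e k).
  by apply/funext => k /=; rewrite /e -!mulrDr; congr (_ * _); ring.
by apply: cvgD => //; apply: cvgD.
Qed.

End Growth.

(** * Iterates of an endomorphism *)

Section Images.
Variables (A B : comNzRingType) (g : {rmorphism A -> B}).
Implicit Types (I X : set A) (J K : set B).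

Lemma ideal_preimage K : ideal K -> ideal (g @^-1` K).
Proof.
move=> iK; apply/idealP; split; first by rewrite /preimage /= rmorph0; apply: ideal0.
move=> a x y Kx Ky; rewrite /preimage /= rmorphD rmorphM.
by apply: idealD => //; apply: ideal_mull.
Qed.

Lemma prime_preimage K : prime_ideal K -> prime_ideal (g @^-1` K).
Proof.
move=> [iK /(proper_idealT iK) K1 mK]; split; first exact: ideal_preimage.
  by move=> KT; apply: K1; rewrite -(rmorph1 g) -[K _]/((g @^-1` K) 1) KT.
by move=> x y; rewrite /preimage /= rmorphM => /mK.
Qed.

Lemma ideal_gen_image X : ideal_gen (g @` ideal_gen X) = ideal_gen (g @` X).
Proof.
apply/seteqP; split; apply: ideal_gen_min; try exact: ideal_gen_ideal; last first.
  by move=> _ [x Xx <-]; apply: sub_ideal_gen; exists x => //; apply: sub_ideal_gen.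
move=> _ [x Xx <-]; move: x Xx.
apply: (@ideal_gen_min _ X (g @^-1` ideal_gen (g @` X))).
  exact/ideal_preimage/ideal_gen_ideal.
by move=> x Xx; apply: sub_ideal_gen; exists x.
Qed.

(** A prime containing IB + J pulls back to a prime containing [I], hence [m]; so it contains mB + J
    and therefore [n]. *)
Lemma radical_ext_sum (m : set A) (n : set B) I J : noetherian B ->
  ideal J -> n `<=` radical (ext_sum g m J) -> m `<=` radical I ->
  n `<=` radical (ext_sum g I J).
Proof.
move=> nB iJ nrad mrad x nx; apply: contrapT => Ix.
have iE := ideal_ext_sum g I iJ.
have [Q [pQ EQ Qx]] := not_radical_prime nB iE Ix; have [iQ _ _] := pQ.
apply/Qx/(prime_radical pQ _ (nrad x nx)).
apply: ext_sum_min => // [a ma|].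
  apply: (prime_radical (prime_preimage pQ) _ (mrad a ma)) => b Ib.
  exact/EQ/ext_sum_image.
exact: subset_trans (@sub_ext_sum _ _ g I J) EQ.
Qed.

End Images.

Section Iterates.
Variables (A : comNzRingType) (theta : {rmorphism A -> A}).

Fixpoint iter_rmorph k : {rmorphism A -> A} :=
  if k is k'.+1 then GRing.RMorphism.clone _ _ (theta \o iter_rmorph k') _
  else GRing.RMorphism.clone _ _ idfun _.

Lemma iter_rmorphE k x : iter_rmorph k x = iter k theta x.
Proof. by elim: k => //= k ->. Qed.

Lemma iter_rmorph_image k (X : set A) : iter k theta @` X = iter_rmorph k @` X.
Proof. by apply: eq_imagel => x _; rewrite iter_rmorphE. Qed.

Variable n : set A.
Hypotheses (locA : noetherian_local n) (thetafl : finite_length_hom n n theta).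

Lemma radical_iter k : n `<=` radical (ext_sum (iter_rmorph k) n [set 0]).
Proof.
have i0 := ideal_set0 A; elim: k => [|k IH].
  move=> x nx; exists 1%N; rewrite expr1.
  exact: (@ext_sum_image _ _ (iter_rmorph 0) n _ x).
have -> : ext_sum (iter_rmorph k.+1) n [set 0] =
    ext_sum theta (ext_sum (iter_rmorph k) n [set 0]) [set 0].
  by rewrite !ext_sum0 ideal_gen_image -image_comp.
apply: (radical_ext_sum (local_noetherian locA) i0 _ IH).
by case: thetafl => _ [_]; rewrite ext_sum0 => ->.
Qed.

Variable J : set A.
Hypotheses (iJ : ideal J) (Jn : J `<=` n) (thetaJ : forall x, J x -> J (theta x)).

Lemma iter_stable k x : J x -> J (iter_rmorph k x).
Proof. by elim: k => //= k IH /IH/thetaJ. Qed.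

Lemma ext_sum_iter_stable k : ext_sum (iter_rmorph k) J J = J.
Proof.
apply/seteqP; split; last exact: sub_ext_sum.
by apply: ext_sum_min => // x; apply: iter_stable.
Qed.

Lemma iter_max k x : n x -> n (iter_rmorph k x).
Proof.
elim: k => //= k IH /IH nx.
by case: thetafl => + _; apply; exists (iter_rmorph k x).
Qed.

Lemma ext_sum_iter_add k l :
  ext_sum (iter_rmorph k) (ext_sum (iter_rmorph l) n J) J =
  ext_sum (iter_rmorph (k + l)) n J.
Proof.
have iterD x : iter_rmorph (k + l) x = iter_rmorph k (iter_rmorph l x).
  by rewrite !iter_rmorphE iterD.
have iE X g : ideal (ext_sum (iter_rmorph g) X J) by exact: ideal_ext_sum.
have sub : ext_sum (iter_rmorph l) n J `<=`
    iter_rmorph k @^-1` ext_sum (iter_rmorph (k + l)) n J.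
  apply: ext_sum_min; first exact: ideal_preimage.
    by move=> x nx; rewrite /preimage /= -iterD; apply: ext_sum_image.
  by move=> x Jx; apply/sub_ext_sum/iter_stable.
apply/seteqP; split; apply: ext_sum_min => //; try exact: sub_ext_sum.
by move=> x nx; rewrite iterD; do 2!apply: ext_sum_image => //.
Qed.

(** Taking J = 0 serves [phi] and [psi], and J = mS serves the induced map. Submultiplicativity is
    [colength_ext_le] for the k-th iterate applied to the ideal of the l-th. *)
Lemma colength_iter_ex : exists c : nat -> nat,
  [/\ forall k, colength n (ext_sum (iter_rmorph k) n J) (c k),
      forall k, (0 < c k)%N & forall k l, (c (k + l) <= c k * c l)%N].
Proof.
have iE k : ideal (ext_sum (iter_rmorph k) n J) by exact: ideal_ext_sum.
have /choice[c colc] k : exists l, colength n (ext_sum (iter_rmorph k) n J) l.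
  apply: colength_ex => // x /(radical_iter k)[i xi]; exists i.
  by apply: ext_sumS xi => // _ ->; apply: ideal0.
exists c; split=> // [k|k l].
  apply: colength_gt0 (colc k) => E1; apply: (max_ideal_proper locA).
  by apply: ext_sum_min E1 => //; [exact: max_ideal|exact: iter_max].
have [i ile coli] := colength_ext_le locA iJ (colc l) (colc k).
rewrite ext_sum_iter_add in coli.
by rewrite (colength_uniq locA (colc _) coli) mulnC.
Qed.

End Iterates.

(** * Entropies as growth rates of colengths *)

Lemma quotring_ideal_gen (A : comNzRingType) (Y Z : set A) :
  [set x | ideal_gen (\pi_(quotring Y) @` Z) (\pi_(quotring Y) x)] =
  ideal_sum (ideal_gen Z) (ideal_gen Y).
Proof.
set X := _ @` Z; set L := ideal_sum _ _.
have iY := ideal_gen_ideal Y; have iZ := ideal_gen_ideal Z.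
have iL : ideal L by exact: ideal_ideal_sum.
have piM (x y : A) :
    \pi_(quotring Y) (x * y) = \pi_(quotring Y) x * \pi_(quotring Y) y.
  by rewrite -quotring_mul_pi.
have pi0 : \pi_(quotring Y) 0 = 0 by exact: (@quotmod_pi0 A A^o).
have [/set_mem X0 XL] := @submod_gen_submodule (quotring Y) (quotring Y)^o X.
apply/seteqP; split=> [x|].
  suff sub : ideal_gen X `<=` \pi_(quotring Y) @` L.
    move=> /sub[y Ly /quotring_eqP Yyx].
    have -> : x = y - (y - x) by ring.
    by apply: idealB => //; apply: sub_ideal_sumr.
  apply: smallest_sub => [|_ [z Zz <-]]; last first.
    by exists z => //; apply: sub_ideal_suml => //; apply: sub_ideal_gen.
  split=> [|a u v /set_mem[y Ly <-] /set_mem[z Lz <-]]; apply/mem_set.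
    by exists 0; [exact: ideal0|exact: pi0].
  exists (repr a * y + z); first by apply: idealD => //; apply: ideal_mull.
  by rewrite quotring_piD piM reprK.
have iK : ideal [set x | ideal_gen X (\pi_(quotring Y) x)].
  apply/idealP; split=> [|a x y Xx Xy]; rewrite /= ?pi0 //.
  by rewrite quotring_piD piM; apply/set_mem/XL; apply/mem_set.
apply: ideal_sum_min => //; apply: ideal_gen_min => // z Zz.
  by apply: sub_gen_smallest; exists z.
rewrite /=; have -> : \pi_(quotring Y) z = 0; last exact: X0.
by rewrite -pi0; apply/quotring_eqP; rewrite subr0; apply: sub_ideal_gen.
Qed.

Section EntropyColength.
Variables (F : realType) (A : comNzRingType) (n : set A).
Hypothesis locA : noetherian_local n.
Variables (theta : {rmorphism A -> A}) (c : nat -> nat).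

Lemma local_entropy_colength :
  (forall k, colength n (ext_sum (iter_rmorph theta k) n [set 0]) (c k)) ->
  local_entropy F n theta = limn (fun k => k%:R^-1 * ln (c k)%:R : F).
Proof.
move=> colc; congr (limn _); apply/funext => k; congr (_ * ln _).
rewrite (module_length_colength locA F (g := idfun) (l := c k)
  (p := \pi_(quotmod (iter k theta @` n : set A^o)))) //=.
- by move=> a; exists a.
- by move=> q; exists (repr q); rewrite reprK.
- by move=> x y; exact: (@quotmod_piD A A^o).
- by move=> a x; exact: (@quotmod_piZ A A^o).
suff -> : [set x | \pi_(quotmod (iter k theta @` n : set A^o)) x = 0] =
    ext_sum (iter_rmorph theta k) n [set 0] by exact: colc.
rewrite ext_sum0 -iter_rmorph_image; apply/seteqP; split=> x.
  by move/(@quotmod_pi_eq0 A A^o).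
by move=> ?; apply/(@quotmod_pi_eq0 A A^o).
Qed.

Variables (Y : set A) (thetabar : quotring Y -> quotring Y).
Hypothesis thetabarE :
  forall x, thetabar (\pi_(quotring Y) x) = \pi_(quotring Y) (theta x).

Lemma local_entropy_quot_colength :
  (forall k, colength n (ext_sum (iter_rmorph theta k) n (ideal_gen Y)) (c k)) ->
  local_entropy F (\pi_(quotring Y) @` n) thetabar =
  limn (fun k => k%:R^-1 * ln (c k)%:R : F).
Proof.
move=> colc; congr (limn _); apply/funext => k; congr (_ * ln _).
set X := iter k thetabar @` _.
have XE : X = \pi_(quotring Y) @` (iter_rmorph theta k @` n).
  rewrite /X !image_comp; apply: eq_imagel => x _ /=; rewrite iter_rmorphE.
  by elim: k {X} => //= k ->; rewrite thetabarE.
rewrite (module_length_colength locA F (g := \pi_(quotring Y)) (l := c k)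
  (p := fun x => \pi_(quotmod (X : set (quotring Y)^o)) (\pi_(quotring Y) x))) //=.
- by move=> r; exists (repr r); rewrite reprK.
- by move=> q; exists (repr (repr q : quotring Y)); rewrite !reprK.
- by move=> x y; rewrite quotring_piD (@quotmod_piD _ (quotring Y)^o).
- move=> a x; rewrite -(@quotmod_piZ _ (quotring Y)^o); congr (\pi_ _ _).
  by rewrite -quotring_mul_pi.
suff -> : [set x |
      \pi_(quotmod (X : set (quotring Y)^o)) (\pi_(quotring Y) x) = 0] =
    ext_sum (iter_rmorph theta k) n (ideal_gen Y) by exact: colc.
rewrite /ext_sum -quotring_ideal_gen -XE; apply/seteqP; split=> x.
  by move/(@quotmod_pi_eq0 _ (quotring Y)^o).
by move=> ?; apply/(@quotmod_pi_eq0 _ (quotring Y)^o).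
Qed.

End EntropyColength.

Theorem theorem1 (K : realType) (R S : comNzRingType) (m : set R) (n : set S)
    (hR : noetherian_local m) (hS : noetherian_local n)
    (phi : {rmorphism R -> R}) (psi : {rmorphism S -> S})
    (hphi : finite_length_hom m m phi) (hpsi : finite_length_hom n n psi)
    (f : {rmorphism R -> S}) (hf : local_hom m n f) (hflat : flat_hom f)
    (hcomm : psi \o f =1 f \o phi)
    (psibar : {rmorphism quotring (f @` m) -> quotring (f @` m)})
    (hpsibar : forall x : S,
       psibar (\pi_(quotring (f @` m)) x) = \pi_(quotring (f @` m)) (psi x))
    (hCM : cohen_macaulay n) :
  local_entropy K n psi =
  local_entropy K m phi
  + local_entropy K (\pi_(quotring (f @` m)) @` n) psibar.
Proof.
have i0R := ideal_set0 R; have i0S := ideal_set0 S.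
have [im in'] := (max_ideal hR, max_ideal hS).
set mS := ideal_gen (f @` m).
have imS : ideal mS by exact: ideal_gen_ideal.
have fmS : ext_sum f m [set 0] = mS by exact: ext_sum0.
have mSn : mS `<=` n by exact: ideal_gen_min.
have psimS : forall x, mS x -> mS (psi x).
  by apply: (ideal_gen_endo hcomm); case: hphi.
have zero_sub (A : comNzRingType) (I : set A) : ideal I -> [set 0] `<=` I.
  by move=> iI _ ->; apply: ideal0.
have zero_stable (A : comNzRingType) (g : {rmorphism A -> A}) x :
    [set (0 : A)] x -> [set (0 : A)] (g x) by move=> ->; rewrite /= rmorph0.
have [a [cola a0 _]] :=
  colength_iter_ex hS hpsi i0S (zero_sub _ _ in') (zero_stable _ psi).
have [b [colb b0 bsub]] :=
  colength_iter_ex hR hphi i0R (zero_sub _ _ im) (zero_stable _ phi).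
have [c [colc c0 csub]] := colength_iter_ex hS hpsi imS mSn psimS.
rewrite (local_entropy_colength K hS cola) (local_entropy_colength K hR colb).
rewrite (local_entropy_quot_colength K hS hpsibar colc).
have [ys [rys radys]] := cohen_macaulay_fiber_params hR hS hf hflat hCM.
rewrite fmS in rys radys.
set q := adjoin_seq mS ys in radys; have iq : ideal q by exact: ideal_adjoin_seq.
have [d cold] := colength_ex hS iq radys.
have ysn := regular_seq_sub rys.
have d0 : (0 < d)%N.
  apply: colength_gt0 cold => q1; apply: (max_ideal_proper hS).
  exact: adjoin_seq_min q1.
(* [C] is the colength of mS + psi^k(y)S, and [b k * C] turns out to be that of psi^k(q)S. Lower
   bounds come from q inside n, upper bounds from the length [d] of S/q. *)
have main k : exists C, [/\ (a k <= b k * C)%N, (b k * C <= d * a k)%N,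
    (c k <= C)%N & (C <= d * c k)%N].
  pose Psi := iter_rmorph psi k; pose Phi := iter_rmorph phi k.
  have PsiPhi x : Psi (f x) = f (Phi x).
    rewrite !iter_rmorphE; elim: (k) => //= j ->.
    by rewrite -[LHS]/((psi \o f) _) hcomm.
  pose ws := map Psi ys.
  have wsn : {in ws, forall x, n x}.
    by move=> _ /mapP[y /ysn ny ->]; apply: iter_max.
  have wsE : ext_sum Psi q mS = adjoin_seq mS ws.
    by rewrite ext_sum_adjoin_seql // ext_sum_iter_stable.
  have radws : n `<=` radical (adjoin_seq mS ws).
    rewrite -wsE; apply: (radical_ext_sum (local_noetherian hS) imS _ radys).
    move=> x /(radical_iter hS hpsi k)[i xi]; exists i.
    by apply: ext_sumS xi => //; apply: zero_sub.
  (* [ws] has as many terms as [ys], and [ys] bounds the depth of the fiber from below. *)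
  have [|vs rvs vsE] := regular_seq_of_params hS imS radws wsn.
    by rewrite size_map; apply: regular_seq_depth_ge.
  (* Flatness of S/J needs the regular sequence [vs]; [fJ] then returns to [ws] in the ideals IS +
     J. *)
  pose J := adjoin_seq [set 0] vs; have iJ : ideal J by exact: ideal_adjoin_seq.
  have flatJ : flat_mod f J.
    apply: (flat_regular_seq hR hS hf i0S (flat_hom_flat_mod hflat) _).1.
    by rewrite fmS.
  have fJ I : ideal I -> ext_sum f I J = adjoin_seq (ext_sum f I [set 0]) ws.
    move=> iI; rewrite ext_sum_adjoin_seqr // vsE //; exact: ideal_ext_sum.
  have [C colC] := colength_ex hS (ideal_adjoin_seq ws imS) radws.
  have colbC := colength_ext_flat hR iJ flatJ (colb k).
  have {colbC} colbC : colength n (ext_sum Psi q [set 0]) (b k * C).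
    suff <- : ext_sum f (ext_sum Phi m [set 0]) J = ext_sum Psi q [set 0].
      by apply: colbC; rewrite fJ // fmS.
    rewrite fJ; last exact: ideal_ext_sum.
    rewrite ext_sum_adjoin_seql // !ext_sum0 !ideal_gen_image !image_comp.
    congr (adjoin_seq (ideal_gen _) _).
    by apply: eq_imagel => x _ /=; rewrite PsiPhi.
  exists C; split.
  - have [|l lbC coll] := colength_le hS (ideal_ext_sum Psi n i0S) _ colbC.
      by apply: ext_sumS => //; apply: adjoin_seq_min.
    by rewrite (colength_uniq hS (cola k) coll).
  - have [l lda coll] := colength_ext_le hS i0S cold (cola k).
    by rewrite (colength_uniq hS colbC coll).
  - have [|l lC coll] := colength_le hS (ideal_ext_sum Psi n imS) _ colC.
      by rewrite -wsE; apply: ext_sumS => //; apply: adjoin_seq_min.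
    by rewrite (colength_uniq hS (colc k) coll).
  - have [l ldc coll] := colength_ext_le hS imS cold (colc k).
    by rewrite wsE in coll; rewrite (colength_uniq hS colC coll).
apply: (@growth_rate_add _ _ _ _ d) => // k; have [C [aC Ca cC Cc]] := main k.
  by rewrite (leq_trans aC) // mulnCA leq_mul2l Cc orbT.
by rewrite (leq_trans _ Ca) // leq_mul2l cC orbT.
Qed.
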